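(* Let $[L;R;P]$ be an HM representation, over the reals, of a $2\times2$ matrix multiplication algorithm using $7$ products. Then its $\gamma_{2,1}$ growth factor satisfies $$\gamma_{2,1}\ \ge\ \frac{28}{9}\,2^{\frac{11}{14}}\,3^{\frac{5}{7}}\ >\ 11.7554696 .$$
   Context: An HM representation $[L;R;P]$ of a $2\times2$ matrix multiplication algorithm with $7$ products consists of real matrices $L,R,P\in\mathbb{R}^{7\times4}$, $P=(p_{i,j})$, such that for all real $2\times2$ matrices $A,B$ the four numbers $\sum_{i=1}^7 (L_i\cdot\mathrm{vec}A)(R_i\cdot\mathrm{vec}B)\,p_{i,j}$, $j=1,\dots,4$, are the four entries of the product $AB$ (in a fixed order); here $\mathrm{vec}$ is row-major vectorization and $L_i,R_i,P_i$ denote $i$-th rows. Its $\gamma_{2,1}$ growth factor is $$\gamma_{2,1}=\sum_{i=1}^{7}\|L_i\|_2\,\|R_i\|_2\,\|P_i\|_2 .$$ *)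

(* Defs.v *)
From mathcomp Require Import all_boot all_order all_algebra all_fingroup.
From mathcomp Require Import reals exp.
Set Implicit Arguments.
Unset Strict Implicit.
Unset Printing Implicit Defensive.
Import Order.TTheory GRing.Theory Num.Theory.
Local Open Scope ring_scope.

Definition dot (K : realType) (n : nat) (u v : 'rV[K]_n) : K :=
  \sum_(k < n) u 0 k * v 0 k.

(* Not `|u|, which on matrices is the sup norm. *)
Definition norm2 (K : realType) (n : nat) (u : 'rV[K]_n) : K :=
  Num.sqrt (\sum_(k < n) u 0 k ^+ 2).

Definition vec (K : realType) (A : 'M[K]_2) : 'rV[K]_4 := mxvec A.

(* The documentation of mxvec does not fix the order of the entries. *)
Lemma vec_row_major (K : realType) (A : 'M[K]_2) (i j : 'I_2) :
  vec A 0 (inord (2 * i + j)) = A i j.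
Proof.
rewrite -[RHS]mxvecE; congr (mxvec A 0 _); apply: val_inj.
rewrite /= inordK; last by case: i j => [[|[|[]]] //= ?] [[|[|[]]] //=].
rewrite /enum_rank enum_rank_in.unlock insubdK; last first.
  by rewrite unfold_in cardE index_mem mem_enum.
rewrite enumT unlock /= /prod_enum.
pose f (p : 'I_2 * 'I_2) := (val p.1, val p.2).
have f_inj : injective f.
  by move=> [a b] [c d] [/val_inj/= -> /val_inj/= ->].
rewrite -(index_map f_inj) map_allpairs.
have -> : [seq f (x, y) | x <- enum 'I_2, y <- enum 'I_2] =
    [seq (a, b) | a <- map val (enum 'I_2), b <- map val (enum 'I_2)].
  by rewrite allpairs_mapl (allpairs_mapr _ (fun=> val)).
rewrite val_enum_ord.
by case: i j => [[|[|[]]] //= ?] [[|[|[]]] //=].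
Qed.

(* sigma fixes the order in which the columns of P list the entries of the
   product; sigma = 1 is the row-major order, and the order making
   (A, B, C) |-> \tr (A *m B *m C) the associated trilinear form is another
   instance. *)
Definition is_HM (K : realType) (sigma : {perm 'I_4}) (L R P : 'M[K]_(7, 4)) :
    Prop :=
  forall (A B : 'M[K]_2) (j : 'I_4),
    \sum_(i < 7) dot (row i L) (vec A) * dot (row i R) (vec B) * P i j
    = vec (A *m B) 0 (sigma j).

Definition gamma21 (K : realType) (L R P : 'M[K]_(7, 4)) : K :=
  \sum_(i < 7) norm2 (row i L) * norm2 (row i R) * norm2 (row i P).

(* Main.v *)
(* Write the algorithm as sum_i tr(M_i A) tr(N_i B) tr(O_i C) = tr(A B C), and
   call the support of A the set of i with tr(M_i A) <> 0.  For A fixed the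
   right-hand side is a bilinear form of rank 2 rank(A), so that an invertible
   matrix has support of size at least 4, while a matrix of rank 1 turns out to
   have support of size 2, or at least 4.  Matrices with support of size 2 (for
   M, N or O) exist, and force so much that the algorithm is Strassen's, up to
   A -> Y A X^-1, B -> X B Z^-1, C -> Z C Y^-1 and rescaling (de Groote):
   one product has factors proportional to X Y^-1, Z X^-1 and Y Z^-1, and the
   factors of the six others are dyads built from three vectors of sum zero
   (up to sign) for each of X, Y, Z and their inverses.  The product of the
   lengths of three such vectors is smallest, for a given determinant, when they
   form an equilateral triangle, and |W|_F^2 >= 2 |det W|; all the determinants
   cancel, so that the 21 squared norms have product at least 2^39 / 3^18.  The
   inequality between arithmetic and geometric means concludes. *)
From HB Require Import structures.
Require Import Defs.
From mathcomp Require Import all_boot all_order all_algebra all_fingroup.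
From mathcomp Require Import reals exp.
From mathcomp Require Import ring lra zify.
Set Implicit Arguments.
Unset Strict Implicit.
Unset Printing Implicit Defensive.
Import Order.TTheory GRing.Theory Num.Theory.
Local Open Scope ring_scope.

(** * Matrices and the trace form *)

Section TraceForm.
Variable K : fieldType.

(** Fewer than four linear conditions always leave a nonzero 2x2 matrix, and feeding it to the
    trilinear identity kills products; the basic count obtained this way is that at most two [M i]
    kill a given nonzero vector. The obstacle is the existence of a word. If [M] and [N] had none,
    any four of the forms tr(M_i A) would be independent. The determinant cannot then vanish on all
    common zeros of three of them, and a change of variables moves an invertible such zero to the
    identity. Three of the [M i] then have trace 0, the other four products turn [N] and [O] into
    dual bases, and Cayley-Hamilton in these bases is contradictory. One word suffices because it
    generates words of the other kinds on neighbouring indices, which have to close up into a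
    hexagon since there are only seven indices; the seventh is the product without dyads. In 2^39 /
    3^18, each of X, Y, Z together with its inverse accounts for (64/27)^2 = 2^12 / 3^6, and the
    central product for 2^3. *)

Lemma mxtrace_mul_neq0 m n (X : 'M[K]_(m, n)) :
  X != 0 -> exists Y : 'M_(n, m), \tr (X *m Y) != 0.
Proof.
case/matrix0Pn=> i [j Xij]; exists (delta_mx j i).
rewrite -(@mul_delta_mx K n 1 m 0) mulmxA mxtrace_mulC.
by rewrite -colE -rowE trace_mx11 !mxE.
Qed.

Lemma mxtrace_mul_eq0 m n (X : 'M[K]_(m, n)) :
  (forall Y : 'M_(n, m), \tr (X *m Y) = 0) -> X = 0.
Proof.
move=> XY; apply/eqP/negPn/negP => /mxtrace_mul_neq0[Y].
by rewrite XY eqxx.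
Qed.

(** Dimension count: [#|S|] linear conditions cannot cut a space of dimension [n * m] down to 0. *)
Lemma common_zero (I : finType) m n (S : {set I}) (X : I -> 'M[K]_(m, n)) :
  (#|S| < n * m)%N ->
  exists2 B : 'M_(n, m), B != 0 & forall i, i \in S -> \tr (X i *m B) = 0.
Proof.
move=> ltS.
pose f (v : 'rV[K]_(n * m)) : 'rV_#|S| :=
  \row_j \tr (X (enum_val j) *m vec_mx v).
have f_lin : linear f.
  move=> a u v; apply/rowP=> j; rewrite !mxE linearP linearP /=.
  by rewrite linearP.
pose fL : {linear _ -> _} := HB.pack f (GRing.isLinear.Build _ _ _ _ f f_lin).
have /rowV0Pn[v /sub_kermxP vG v0] : kermx (lin1_mx fL) != 0.
  rewrite kermx_eq0 -row_leq_rank -ltnNge.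
  exact: leq_ltn_trans (rank_leq_col _) ltS.
exists (vec_mx v); first by rewrite vec_mx_eq0.
move=> i Si; rewrite mul_rV_lin1 in vG.
have := congr1 (fun w : 'rV_ _ => w 0 (enum_rank_in Si i)) vG.
by rewrite !mxE enum_rankK_in.
Qed.

Lemma exists_mul_eq1 n (u : 'cV[K]_n) :
  u != 0 -> exists t : 'rV_n, t *m u = 1%:M.
Proof.
move=> u0; have [t tu | u_eq0] := pickP (fun i => u i 0 != 0); last first.
  case/eqP: u0; apply/colP=> i; rewrite mxE; apply/eqP.
  by move/negbFE: (u_eq0 i).
exists ((u t 0)^-1 *: delta_mx 0 t).
rewrite -scalemxAl -rowE; apply/rowP=> i.
by rewrite !ord1 !mxE mulVf.
Qed.

Lemma exists_mul_eq1_row n (p : 'rV[K]_n) : p != 0 -> exists x : 'cV_n,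
  p *m x = 1%:M.
Proof.
move=> p0; have [|t /(congr1 trmx)] := @exists_mul_eq1 _ p^T.
  by rewrite trmx_eq0.
by rewrite trmx_mul trmxK tr_scalar_mx => pt; exists t^T.
Qed.

Lemma col_mul_eq0 m n (u : 'cV[K]_m) (X : 'M_(1, n)) :
  u != 0 -> u *m X = 0 -> X = 0.
Proof.
case/exists_mul_eq1=> t tu /(congr1 (mulmx t)).
by rewrite mulmxA tu mul1mx mulmx0.
Qed.

Lemma rows_mul_eq0 m n (X : 'M[K]_(m, n)) : (forall p : 'rV_m, p *m X = 0) -> X = 0.
Proof. by move=> X0; apply/row_matrixP=> i; rewrite rowE X0 row0. Qed.

Lemma cols_mul_eq0 m n (X : 'M[K]_(m, n)) : (forall q : 'cV_n, X *m q = 0) -> X = 0.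
Proof.
move=> X0; apply: trmx_inj; rewrite trmx0; apply: rows_mul_eq0 => p.
by rewrite -[p]trmxK -trmx_mul X0 trmx0.
Qed.

Lemma row_mul_eq0 m n (t : 'rV[K]_n) (X : 'M_(m, 1)) :
  t != 0 -> X *m t = 0 -> X = 0.
Proof.
move=> t0 /(congr1 trmx); rewrite trmx_mul trmx0 => /col_mul_eq0 X0.
by apply: trmx_inj; rewrite trmx0 X0 // trmx_eq0.
Qed.

Lemma exists_orthogonal_row (u : 'cV[K]_2) : exists2 t : 'rV_2, t != 0 & t *m u = 0.
Proof.
have [|t t0 tu] := @common_zero unit _ _ [set tt] (fun=> u);
  first by rewrite cards1.
exists t => //; have := tu tt; rewrite set11 mxtrace_mulC => /(_ isT).
by rewrite trace_mx11 => tu0; apply/matrixP=> i j; rewrite !ord1 tu0 mxE.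
Qed.

Lemma exists_orthogonal_col (p : 'rV[K]_2) : exists2 q : 'cV_2, q != 0 & p *m q = 0.
Proof.
have [q q0 pq] := exists_orthogonal_row p^T; exists q^T.
  by rewrite trmx_eq0.
by apply: trmx_inj; rewrite trmx_mul trmxK pq trmx0.
Qed.

Lemma orthogonal_cols_parallel (p : 'rV[K]_2) (q q' : 'cV_2) :
  p != 0 -> q != 0 -> p *m q = 0 -> p *m q' = 0 -> exists a, q' = a *: q.
Proof.
move=> p0 q0 pq pq'.
have sub_ker (r : 'cV[K]_2) : p *m r = 0 -> (r^T <= kermx p^T)%MS.
  by move=> pr; apply/sub_kermxP; rewrite -trmx_mul pr trmx0.
have rk1 n (v : 'rV[K]_n) : v != 0 -> \rank v = 1%N.
  by move=> v0; apply/eqP; rewrite eqn_leq rank_leq_row lt0n mxrank_eq0.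
have rk_ker : \rank (kermx p^T) = 1%N by rewrite mxrank_ker mxrank_tr rk1.
have/sub_ker qk := pq; have/sub_ker q'k := pq'.
have: (kermx p^T <= q^T)%MS.
  by rewrite -(geq_leqif (mxrank_leqif_sup qk)) rk_ker rk1 // trmx_eq0.
move/(submx_trans q'k)=> /sub_rVP[a qa]; exists a.
by apply: trmx_inj; rewrite qa linearZ.
Qed.

Lemma orthogonal_rows_parallel (q : 'cV[K]_2) (p p' : 'rV_2) :
  q != 0 -> p != 0 -> p *m q = 0 -> p' *m q = 0 -> exists a, p' = a *: p.
Proof.
move=> q0 p0 pq p'q.
have [||||a /(congr1 trmx)] := @orthogonal_cols_parallel q^T p^T p'^T;
  rewrite ?trmx_eq0 -?trmx_mul ?pq ?p'q ?trmx0 //.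
by rewrite linearZ /= !trmxK; exists a.
Qed.

Lemma singular_rank1 (A : 'M[K]_2) : A != 0 -> A \notin unitmx ->
  exists u : 'cV_2, exists p : 'rV_2, [/\ u != 0, p != 0 & A = u *m p].
Proof.
rewrite -row_free_unit -row_leq_rank -ltnNge -mxrank_eq0 => A0 A2.
have rA : \rank A = 1%N by apply/eqP; rewrite eqn_leq -ltnS A2 lt0n.
have := mulmx_base A; move: (col_base A) (row_base A); rewrite rA => u p up.
exists u, p; rewrite up; split=> //; apply: contraNneq A0 => e0.
  by rewrite -up e0 mul0mx mxrank0.
by rewrite -up e0 mulmx0 mxrank0.
Qed.

End TraceForm.

(** * Trilinear form of an algorithm *)

Section Decomposition.
Variable K : fieldType.
Implicit Types M N O : 'I_7 -> 'M[K]_2.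

Definition trdecomp M N O :=
  forall A B C, \sum_i \tr (M i *m A) * \tr (N i *m B) * \tr (O i *m C)
                = \tr (A *m B *m C).

Definition supp M (A : 'M[K]_2) : {set 'I_7} := [set i | \tr (M i *m A) != 0].

Lemma trdecomp_rot M N O : trdecomp M N O -> trdecomp N O M.
Proof.
move=> dec A B C; rewrite mxtrace_mulC mulmxA -dec.
by apply: eq_bigr => i _; ring.
Qed.

Lemma trdecomp_tr M N O : trdecomp M N O ->
  trdecomp (fun i => (O i)^T) (fun i => (N i)^T) (fun i => (M i)^T).
Proof.
move=> dec A B C; rewrite -mxtrace_tr !trmx_mul mulmxA -dec.
apply: eq_bigr => i _.
have trE (X Y : 'M[K]_2) : \tr (X^T *m Y) = \tr (X *m Y^T).
  by rewrite -mxtrace_tr trmx_mul trmxK mxtrace_mulC.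
by rewrite !trE; ring.
Qed.

(** If three [M i] killed [u], at most four products would survive for [A = u p]. Nondegeneracy in
    [B] makes them exactly four, with their [N i] a basis of the linear forms. Testing on the dual
    basis shows that the surviving [O i] vanish on every [C] with [C u = 0]; a nonzero [B] killed by
    the three [N i] of [S] then satisfies [B = 0]. *)
Lemma card_kill_col M N O (u : 'cV_2) : trdecomp M N O -> u != 0 ->
  (#|[set i | M i *m u == 0%R]| <= 2)%N.
Proof.
move=> dec u0; set S := [set i | _]; rewrite leqNgt; apply/negP => ltS.
pose T := ~: S.
have cT : (#|S| + #|T| = 7)%N by rewrite cardsC card_ord.
have MS i (p : 'rV_2) : i \in S -> \tr (M i *m (u *m p)) = 0.
  by rewrite inE mulmxA => /eqP->; rewrite mul0mx mxtrace0.
have NT B : (forall i, i \in T -> \tr (N i *m B) = 0) -> B = 0.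
  move=> B0; apply: rows_mul_eq0 => p; apply: (col_mul_eq0 u0).
  apply: mxtrace_mul_eq0 => C; rewrite mulmxA -dec big1 // => i _.
  have [/MS->|] := boolP (i \in S); first by rewrite !mul0r.
  by rewrite -in_setC => /B0->; rewrite mulr0 mul0r.
have cT4 : #|T| = 4%N.
  apply/eqP; rewrite eqn_leq; apply/andP; split; first lia.
  rewrite leqNgt; apply/negP => ltT.
  by have [B /eqP B0 /NT] := @common_zero K _ 2 2 T N ltT.
have OT i C : i \in T -> C *m u = 0 -> \tr (O i *m C) = 0.
  move=> Ti Cu.
  have [|B B0 BT] := @common_zero K _ 2 2 (T :\ i) N.
    by have := cardsD1 i T; rewrite Ti cT4; lia.
  have NiB : \tr (N i *m B) != 0.
    apply: contra B0 => /eqP NiB; apply/eqP/NT => j Tj.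
    by have [->//|ji] := eqVneq j i; apply: BT; rewrite in_setD1 ji.
  have [p Mip] : exists p : 'rV_2, \tr (M i *m (u *m p)) != 0.
    have /mxtrace_mul_neq0[p Mp] : M i *m u != 0 by move: Ti; rewrite !inE.
    by exists p; rewrite mulmxA.
  have := dec (u *m p) B C; rewrite (bigD1 i) //= big1 => [|j ji].
    rewrite addr0 [RHS]mxtrace_mulC !mulmxA Cu !mul0mx mxtrace0 => /eqP.
    by rewrite !mulf_eq0 -!mulmxA (negPf Mip) (negPf NiB) => /eqP.
  have [/MS->|nSj] := boolP (j \in S); first by rewrite !mul0r.
  by rewrite BT ?mulr0 ?mul0r // in_setD1 ji in_setC.
have [|B B0 BS] := @common_zero K _ 2 2 S N; first lia.
have [t t0 tu] := exists_orthogonal_row u.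
case/eqP: B0; apply: cols_mul_eq0 => w; apply: (row_mul_eq0 t0).
apply: mxtrace_mul_eq0 => A.
rewrite mxtrace_mulC -[B *m w *m t]mulmxA [A *m _]mulmxA -dec big1 // => i _.
have [/BS->|] := boolP (i \in S); first by rewrite mulr0 mul0r.
by rewrite -in_setC => /OT->; rewrite ?mulr0 // -mulmxA tu mulmx0.
Qed.

Lemma card_kill_row M N O (t : 'rV_2) : trdecomp M N O -> t != 0 ->
  (#|[set i | t *m M i == 0%R]| <= 2)%N.
Proof.
move=> dec t0; have := card_kill_col (u := t^T) (trdecomp_tr (trdecomp_rot dec)).
rewrite trmx_eq0 => /(_ t0).
congr (_ <= _)%N; apply: eq_card => i.
by rewrite !inE -trmx_mul trmx_eq0.
Qed.

(* Two-term expressions of the bilinear form (B, C) |-> p B C u, which has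
   rank 2: both factors of each term are then forced. *)
Section TwoTerms.
Variables (u : 'cV[K]_2) (p : 'rV[K]_2) (X1 X2 Y1 Y2 : 'M[K]_2).
Hypotheses (u0 : u != 0) (p0 : p != 0).
Hypothesis XY : forall B C, \tr (u *m p *m B *m C) =
  \tr (X1 *m B) * \tr (Y1 *m C) + \tr (X2 *m B) * \tr (Y2 *m C).

Lemma two_terms_dual_independent (q : 'cV_2) : Y1 *m q = 0 -> Y2 *m q = 0 -> q = 0.
Proof.
move=> Y1q Y2q; have [y yu] := exists_mul_eq1 u0.
apply: (row_mul_eq0 p0); apply: mxtrace_mul_eq0 => B.
have := XY B (q *m y); rewrite !mulmxA Y1q Y2q !mul0mx mxtrace0 !mulr0 addr0.
by rewrite mxtrace_mulC !mulmxA yu mul1mx mxtrace_mulC !mulmxA.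
Qed.

(** With [y u = 1], some [C = x y] kills the second term; what remains says that [x p] is a nonzero
    multiple of [X1]. *)
Lemma two_terms_kernel (q : 'cV_2) : (X1 *m q == 0) = (p *m q == 0).
Proof.
have [y yu] := exists_mul_eq1 u0.
have [|x x0 /(_ tt (set11 _))] :=
  @common_zero K unit _ _ [set tt] (fun=> y *m Y2); first by rewrite cards1.
rewrite -mulmxA mxtrace_mulC -mulmxA => Y2xy.
have cycle B : \tr (u *m p *m B *m (x *m y)) = \tr (x *m p *m B).
  by rewrite mulmxA mxtrace_mulC !mulmxA yu mul1mx mxtrace_mulC !mulmxA.
apply/eqP/eqP => [X1q | pq].
  apply: (col_mul_eq0 x0); apply: mxtrace_mul_eq0 => v.
  have := XY (q *m v) (x *m y).
  by rewrite Y2xy mulr0 addr0 cycle !mulmxA X1q mul0mx mxtrace0 mul0r.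
apply: mxtrace_mul_eq0 => v; have := XY (q *m v) (x *m y).
rewrite Y2xy mulr0 addr0 cycle [X1 *m _]mulmxA -[x *m p *m _]mulmxA.
rewrite [p *m _]mulmxA pq mul0mx mulmx0 mxtrace0.
move/esym/eqP; rewrite mulf_eq0 => /orP[/eqP//|/eqP Y1xy].
case/eqP: p0; apply: (col_mul_eq0 x0); apply: mxtrace_mul_eq0 => B.
by rewrite -cycle XY Y1xy Y2xy !mulr0 addr0.
Qed.

End TwoTerms.

(** Transposition reverses products, hence exchanges the [X] with the [Y] and [u] with [p]. *)
Lemma two_terms_dual_kernel (u : 'cV[K]_2) (p : 'rV[K]_2) (X1 X2 Y1 Y2 : 'M[K]_2) :
    u != 0 -> p != 0 ->
    (forall B C, \tr (u *m p *m B *m C) =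
      \tr (X1 *m B) * \tr (Y1 *m C) + \tr (X2 *m B) * \tr (Y2 *m C)) ->
  forall t : 'rV_2, (t *m Y1 == 0) = (t *m u == 0).
Proof.
have trE (X Y : 'M[K]_2) : \tr (X^T *m Y) = \tr (X *m Y^T).
  by rewrite -mxtrace_tr trmx_mul trmxK mxtrace_mulC.
move=> u0 p0 XY t; rewrite -trmx_eq0 -[RHS]trmx_eq0 !trmx_mul.
apply: (@two_terms_kernel p^T u^T Y1^T Y2^T X1^T X2^T); rewrite ?trmx_eq0 // => B C.
rewrite !trE -trmx_mul -[LHS]mxtrace_tr -!mulmxA.
rewrite !trmx_mul !trmxK mxtrace_mulC.
rewrite [LHS](_ : _ = \tr (u *m p *m C^T *m B^T)); first by rewrite XY; ring.
by rewrite !mulmxA mxtrace_mulC !mulmxA.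
Qed.

End Decomposition.

(** * Sizes of supports, and the kernels forced by a word *)

Section Words.
Variable K : fieldType.
Implicit Types M N O : 'I_7 -> 'M[K]_2.

Lemma trdecomp_supp M N O A B C : trdecomp M N O ->
  \tr (A *m B *m C) =
  \sum_(i in supp M A) \tr (M i *m A) * \tr (N i *m B) * \tr (O i *m C).
Proof.
move=> dec; rewrite -dec (bigID [in supp M A]) /= [X in _ + X]big1 ?addr0 // => i.
by rewrite inE negbK => /eqP->; rewrite !mul0r.
Qed.

(* A word is a nonzero matrix whose support has size 2; it is then a dyad. *)
Definition word M (u : 'cV_2) (p : 'rV_2) i j :=
  [/\ u != 0, p != 0, i != j & supp M (u *m p) = [set i; j]].

Lemma wordC M u p i j : word M u p i j -> word M u p j i.
Proof. by case=> u0 p0 ij s; split; rewrite // 1?eq_sym // setUC. Qed.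

Section WordKernels.
Variables (M N O : 'I_7 -> 'M[K]_2) (dec : trdecomp M N O).
Variables (u : 'cV[K]_2) (p : 'rV[K]_2) (i j : 'I_7) (w : word M u p i j).

Lemma word_terms B C : \tr (u *m p *m B *m C) =
  \tr (N i *m B) * \tr (\tr (M i *m (u *m p)) *: O i *m C) +
  \tr (N j *m B) * \tr (\tr (M j *m (u *m p)) *: O j *m C).
Proof.
have [_ _ ij s] := w; rewrite (trdecomp_supp _ _ _ dec) s.
by rewrite big_setU1 ?inE //= big_set1 -!scalemxAl !mxtraceZ; ring.
Qed.

Lemma word_coef : \tr (M i *m (u *m p)) != 0.
Proof. by have [_ _ _ /setP/(_ i)] := w; rewrite !inE eqxx. Qed.

Lemma word_col_kernel (q : 'cV_2) : (N i *m q == 0) = (p *m q == 0).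
Proof. by have [u0 p0 _ _] := w; apply: (two_terms_kernel u0 p0 word_terms). Qed.

Lemma word_row_kernel (t : 'rV_2) : (t *m O i == 0) = (t *m u == 0).
Proof.
have [u0 p0 _ _] := w; rewrite -(two_terms_dual_kernel u0 p0 word_terms).
by rewrite -scalemxAr scaler_eq0 (negPf word_coef).
Qed.

Lemma word_dual_independent (q : 'cV_2) : O i *m q = 0 -> O j *m q = 0 -> q = 0.
Proof.
have [u0 p0 _ _] := w; move=> Oi Oj.
by apply: (two_terms_dual_independent u0 p0 word_terms);
  rewrite -scalemxAl ?Oi ?Oj scaler0.
Qed.

End WordKernels.

Lemma card_supp_unit M N O A : trdecomp M N O -> A \in unitmx -> (3 < #|supp M
  A|)%N.
Proof.
move=> dec uA; rewrite ltnNge; apply/negP => le3.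
have [B /eqP B0 BA] := @common_zero K _ 2 2 (supp M A) N le3.
apply: B0; rewrite -[B](mulKmx uA) [A *m B](_ : _ = 0) ?mulmx0 //.
apply: mxtrace_mul_eq0 => C.
by rewrite (trdecomp_supp _ _ _ dec) big1 // => i /BA->; rewrite mulr0 mul0r.
Qed.

Lemma card_supp_gt1 M N O (u : 'cV_2) (p : 'rV_2) :
  trdecomp M N O -> u != 0 -> p != 0 -> (1 < #|supp M (u *m p)|)%N.
Proof.
move=> dec u0 p0; rewrite ltnNge; apply/negP => le1.
have [x px] := exists_mul_eq1_row p0.
have [y y0 yS] := @common_zero K _ _ _ _ (fun i => N i *m x)
  (le1 : #|supp M (u *m p)| < 2 * 1)%N.
case/eqP: y0; apply: (col_mul_eq0 u0); apply: mxtrace_mul_eq0 => C.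
rewrite [LHS](_ : _ = \tr (u *m p *m (x *m y) *m C)); last first.
  by rewrite -[u *m p *m _]mulmxA [p *m _]mulmxA px mul1mx.
rewrite (trdecomp_supp _ _ _ dec) big1 // => i /yS.
by rewrite -mulmxA => ->; rewrite mulr0 mul0r.
Qed.

(* With support of size 3, p B C u is a sum of three terms.  By [card_kill_row]
   the matrices O_i do not all vanish on C = x t for t u = 0, which yields a
   linear relation between the N_i and reduces the three terms to two. *)
Lemma card_supp_neq3 M N O (u : 'cV_2) (p : 'rV_2) :
  trdecomp M N O -> u != 0 -> p != 0 -> #|supp M (u *m p)| != 3%N.
Proof.
move=> dec u0 p0; apply/negP => /eqP c3.
set S := supp _ _ in c3.
have [t t0 tu] := exists_orthogonal_row u.
have [q q0 pq] := exists_orthogonal_col p.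
have nsub (F : {pred 'I_7}) : (#|[set i | F i]| <= 2)%N -> exists2 i,
  i \in S & ~~ F i.
  move=> F2; apply/exists_inP; rewrite -negb_forall_in;
    apply/negP => /forall_inP SF.
  have: (#|S| <= 2)%N by apply: leq_trans F2; apply/subset_leq_card/subsetP =>
    i /SF; rewrite inE.
  by rewrite c3.
have [i Si tOi] := nsub _ (card_kill_row (trdecomp_rot (trdecomp_rot dec)) t0).
have /mxtrace_mul_neq0[x] := tOi; rewrite mxtrace_mulC mulmxA => xtOi.
pose c k := \tr (M k *m (u *m p)) * \tr (O k *m (x *m t)).
have rel : \sum_(k in S) c k *: N k = 0.
  apply: mxtrace_mul_eq0 => B; rewrite mulmx_suml raddf_sum /=.
  have := trdecomp_supp (u *m p) B (x *m t) dec.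
  rewrite mxtrace_mulC !mulmxA -[x *m t *m u]mulmxA tu mulmx0 !mul0mx mxtrace0.
  move=> /esym sum0; rewrite -[RHS]sum0; apply: eq_bigr => k _.
  by rewrite -scalemxAl mxtraceZ /c; ring.
have ci : c i != 0.
  rewrite mulf_eq0 negb_or; move: (Si); rewrite inE => -> /=.
  by rewrite mxtrace_mulC.
have [k [l [kl Sikl]]] : exists k l, k != l /\ S :\ i = [set k; l].
  have/cards2P[k [l [? ?]]] : #|S :\ i| == 2%N by have := c3;
    rewrite (cardsD1 i S) Si add1n => /eqP.
  by exists k, l.
have Ni : N i = - (c k / c i) *: N k - (c l / c i) *: N l.
  move: rel; rewrite (big_setD1 i) //= Sikl big_setU1 ?inE //= big_set1.
  move=> /eqP; rewrite addr_eq0 => /eqP/(congr1 ( *:%R (c i)^-1)).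
  rewrite scalerA mulVf // scale1r => ->.
  by rewrite scalerN scalerDr !scalerA opprD -!scaleNr ![(c i)^-1 * _]mulrC.
pose m k := \tr (M k *m (u *m p)).
have terms B C : \tr (u *m p *m B *m C) =
    \tr (N k *m B) * \tr ((m k *: O k - (c k / c i * m i) *: O i) *m C) +
    \tr (N l *m B) * \tr ((m l *: O l - (c l / c i * m i) *: O i) *m C).
  rewrite (trdecomp_supp _ _ _ dec) (big_setD1 i) //= Sikl big_setU1 ?inE //=
    big_set1.
  rewrite Ni !mulmxDl !mulNmx -!scalemxAl !raddfD /= !raddfN /= !mxtraceZ /m; ring.
have terms' B C := etrans (terms B C) (addrC _ _).
(* The two-term form makes [N k] and [N l] kill [q], and the relation extends this to [N i]: all
   three indices of [S] kill [q], whereas at most two can. *)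
have [j Sj /negP[]] := nsub _ (card_kill_col (trdecomp_rot dec) q0).
have Nk : N k *m q = 0 by apply/eqP; rewrite (two_terms_kernel u0 p0 terms) pq.
have Nl : N l *m q = 0 by apply/eqP; rewrite (two_terms_kernel u0 p0 terms') pq.
have [->|ji] := eqVneq j i.
  by rewrite Ni mulmxBl -!scalemxAl Nk Nl !scaler0 subr0.
have: j \in S :\ i by rewrite in_setD1 ji.
by rewrite Sikl !inE => /orP[]/eqP->; apply/eqP.
Qed.

Lemma word_of_small_supp M N O A : trdecomp M N O -> A != 0 -> (#|supp M A| <= 3)%N
  ->
  exists u p i j, A = u *m p /\ word M u p i j.
Proof.
move=> dec A0 le3; have [|u [p [u0 p0 defA]]] := singular_rank1 A0.
  by apply: contraL le3 => /(card_supp_unit dec); rewrite ltnNge.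
have : #|supp M A| == 2%N.
  have := card_supp_neq3 dec u0 p0; have := card_supp_gt1 dec u0 p0.
  by rewrite -defA; lia.
by case/cards2P=> i [j [ij s]]; exists u, p, i, j; split=> //; split;
  rewrite // -defA.
Qed.

End Words.

(** * From one word to words for the other two factors *)

Section Chain.
Variable K : fieldType.
Implicit Types M N O : 'I_7 -> 'M[K]_2.

Lemma kill_col_uniq M N O (u : 'cV_2) i j k : trdecomp M N O -> u != 0 ->
  M i *m u = 0 -> M j *m u = 0 -> M k *m u = 0 -> ~~ uniq [:: i; j; k].
Proof.
move=> dec u0 Mi Mj Mk; apply: contraTN (card_kill_col dec u0) => ijk.
rewrite -ltnNge; apply: (@leq_trans #|[:: i; j; k]|).
  by rewrite (card_uniqP ijk).
apply/subset_leq_card/subsetP => l.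
by rewrite !inE => /or3P[] /eqP->; apply/eqP.
Qed.

Lemma kill_row_uniq M N O (t : 'rV_2) i j k : trdecomp M N O -> t != 0 ->
  t *m M i = 0 -> t *m M j = 0 -> t *m M k = 0 -> ~~ uniq [:: i; j; k].
Proof.
move=> dec t0 Mi Mj Mk; apply: contraTN (card_kill_row dec t0) => ijk.
rewrite -ltnNge; apply: (@leq_trans #|[:: i; j; k]|).
  by rewrite (card_uniqP ijk).
apply/subset_leq_card/subsetP => l.
by rewrite !inE => /or3P[] /eqP->; apply/eqP.
Qed.

(** The kernels of [N i], [N j] and [N j'] coincide, and at most two of the [N k] can kill the same
    vector. *)
Lemma word_unique M N O u p i j u' p' j' : trdecomp M N O ->
  word M u p i j -> word M u' p' i j' -> j = j'.
Proof.
move=> dec w w'; have [_ _ ij _] := w; have [_ _ ij' _] := w'.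
have [q q0 pq] := exists_orthogonal_col p.
have Ni : N i *m q = 0 by apply/eqP; rewrite (word_col_kernel dec w) pq.
have Nj : N j *m q = 0 by apply/eqP; rewrite (word_col_kernel dec (wordC w)) pq.
have Nj' : N j' *m q = 0.
  by apply/eqP; rewrite (word_col_kernel dec (wordC w')) -(word_col_kernel dec w')
    Ni.
have := kill_col_uniq (trdecomp_rot dec) q0 Ni Nj Nj'.
by rewrite /= !inE (negPf ij) (negPf ij') /= andbT => /negPn/eqP.
Qed.

(* For A = u' p and B = q v one has A B = 0 and the terms i and j vanish, which
   leaves, for every v, a linear relation between the five forms tr(O_k C), k
   outside {i, j}.  Up to a factor these satisfy only one relation, so that the
   relation of a suitable v0 is trivial: q v0 is a word for N.  The relation of
   any other v has support R, which gives two words for O. *)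
Lemma word_chain M N O u p q i j : trdecomp M N O -> word M u p i j ->
    q != 0 -> p *m q = 0 ->
  exists k l v, [/\ word N q v k l, k \notin [:: i; j], l \notin [:: i; j],
    exists z w, word O z w i k & exists z w, word O z w j l].
Proof.
move=> dec w q0 pq; have [u0 p0 ij sM] := w.
pose S := [set i; j]; pose T := ~: S.
have cT : #|T| = 5%N.
  by have := cardsC S; rewrite cards2 ij card_ord -/T add2n => -[->].
have NS k : k \in S -> N k *m q = 0.
  case/set2P=> ->; apply/eqP; first by rewrite (word_col_kernel dec w) pq.
  by rewrite (word_col_kernel dec (wordC w)) pq.
have NSv k v : k \in S -> \tr (N k *m (q *m v)) = 0.
  by move=> Sk; rewrite mulmxA NS // mul0mx mxtrace0.
have MT k : k \in T -> \tr (M k *m (u *m p)) = 0.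
  by rewrite inE -[S]sM inE negbK => /eqP.
have OT C : (forall k, k \in T -> \tr (O k *m C) = 0) -> C = 0.
  move=> C0; apply: rows_mul_eq0 => v; apply: (col_mul_eq0 q0).
  apply: mxtrace_mul_eq0 => A.
  rewrite mxtrace_mulC [q *m _]mulmxA mulmxA -dec big1 // => k _.
  have [/NSv->|nSk] := boolP (k \in S); first by rewrite mulr0 mul0r.
  by rewrite C0 ?mulr0 // in_setC.
have [t t0 tu] := exists_orthogonal_row u.
have [u' tu'] := exists_mul_eq1_row t0.
pose R := [set k in T | \tr (M k *m (u' *m p)) != 0].
(* The row [p M_k] vanishes on [u] because [k] is outside the support of [u p], and on [u'] because
   [k] is outside [R]; these two vectors form a basis. At most two [M k] are killed by [p], so [R]
   has at least three elements. *)
have pM k : k \in T -> k \notin R -> p *m M k = 0.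
  move=> Tk; rewrite inE Tk negbK => /eqP Mk.
  have tr1 (x : 'cV_2) : \tr (M k *m (x *m p)) = 0 -> p *m M k *m x = 0.
    rewrite mulmxA mxtrace_mulC mulmxA trace_mx11 => xMp.
    by apply/matrixP=> a b; rewrite !ord1 xMp mxE.
  have [a pMk] := orthogonal_rows_parallel u0 t0 tu (tr1 _ (MT _ Tk)).
  have := tr1 _ Mk; rewrite pMk -scalemxAl tu' scalemx1 => /(congr1 mxtrace).
  by rewrite mxtrace_scalar mxtrace0 mulr1n => ->; rewrite scale0r.
have RT : R \subset T by apply/subsetP=> k; rewrite inE => /andP[].
have cTR : (#|T :\: R| <= 2)%N.
  apply: leq_trans (card_kill_row dec p0); apply/subset_leq_card/subsetP => k.
  by case/setDP=> Tk nRk; rewrite inE pM.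
have cR : (#|T :\: R| + #|R| = 5)%N.
  by have := cardsID R T; rewrite (setIidPr RT) cT addnC.
have rel v C :
    \sum_k \tr (M k *m (u' *m p)) * \tr (N k *m (q *m v)) * \tr (O k *m C) = 0.
  by rewrite dec -[u' *m p *m _]mulmxA [p *m _]mulmxA pq mul0mx mulmx0 mul0mx
    mxtrace0.
have NT k : k \in T -> N k *m q != 0.
  rewrite inE /S !inE negb_or => /andP[ki kj].
  apply/negP => /eqP Nk.
  have := kill_col_uniq (trdecomp_rot dec) q0 (NS _ (set21 i j)) (NS _ (set22 i j))
    Nk.
  by rewrite /= !inE negb_or ij eq_sym ki eq_sym kj.
have killed v k C : k \in R -> \tr (N k *m (q *m v)) != 0 ->
    (forall l, l \in R -> l != k -> \tr (N l *m (q *m v)) * \tr (O l *m C) = 0) ->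
  \tr (O k *m C) = 0.
  move=> Rk Nk C0; have := rel v C; rewrite (bigD1 k) //= big1 => [|l lk].
    rewrite addr0 => /eqP; rewrite !mulf_eq0 (negPf Nk) orbF.
    by move: Rk; rewrite inE => /andP[_ /negPf->] /eqP.
  have [Rl|nRl] := boolP (l \in R); first by rewrite -mulrA C0 ?mulr0.
  have [/NSv->|nSl] := boolP (l \in S); first by rewrite mulr0 mul0r.
  by move: nRl; rewrite inE in_setC nSl negbK => /eqP->; rewrite !mul0r.
have [i0 Ri0] : exists i0, i0 \in R.
  apply/set0Pn; rewrite -card_gt0; move: cTR cR.
  by case: #|R| => //; rewrite addn0 => /[swap] ->.
have [|v v0 vi0] := @common_zero K unit _ _ [set tt] (fun=> N i0 *m q).
  by rewrite cards1.
have {}vi0 : \tr (N i0 *m (q *m v)) = 0 by rewrite mulmxA (vi0 tt) ?set11.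
(* Otherwise take [C] killed by the three [O l] with [l] in [T] other than [k] and [i0]. The
   relation of [v] yields the zero at [k], then that of [v1] the zero at [i0], so [C] is killed on
   all of [T]. *)
have vR k : k \in R -> \tr (N k *m (q *m v)) = 0.
  move=> Rk; apply/eqP/negPn/negP => vk.
  have ki0 : k != i0 by apply: contraNneq vk => ->; rewrite vi0.
  have [v1 v1i0] : exists v1 : 'rV_2, \tr (N i0 *m (q *m v1)) != 0.
    have /mxtrace_mul_neq0[v1] := NT _ (subsetP RT _ Ri0).
    by exists v1; rewrite mulmxA.
  have [|C C0 CT] := @common_zero K _ 2 2 (T :\ k :\ i0) O.
    have := cardsD1 k T; have := cardsD1 i0 (T :\ k).
    rewrite in_setD1 eq_sym ki0 (subsetP RT _ Rk) (subsetP RT _ Ri0) => ->.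
    by rewrite cT !add1n => -[<-].
  case/eqP: C0; apply: OT.
  have Ok : \tr (O k *m C) = 0.
    apply: (killed v) => // l Rl lk.
    have [->|li0] := eqVneq l i0; first by rewrite vi0 mul0r.
    by rewrite CT ?mulr0 // !in_setD1 li0 lk (subsetP RT).
  have Oi0 : \tr (O i0 *m C) = 0.
    apply: (killed v1) => // l Rl li0.
    have [->|lk] := eqVneq l k; first by rewrite Ok mulr0.
    by rewrite CT ?mulr0 // !in_setD1 li0 lk (subsetP RT).
  move=> l Tl; have [->//|lk] := eqVneq l k; have [->//|li0] := eqVneq l i0.
  by apply: CT; rewrite !in_setD1 li0 lk.
have sN : supp N (q *m v) \subset T :\: R.
  apply/subsetP=> k; rewrite inE in_setD in_setC => Nk; apply/andP; split.
    by apply: contraNN Nk => /vR->.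
  by apply: contraNN Nk => /NSv->.
have c2 := card_supp_gt1 (trdecomp_rot dec) q0 v0.
have /eqP sNE : supp N (q *m v) == T :\: R by rewrite eqEcard sN (leq_trans cTR).
have/cards2P[k [l [kl TRkl]]] : #|T :\: R| == 2%N by rewrite eqn_leq cTR -sNE.
have wN : word N q v k l by split; rewrite // sNE.
have cR3 : #|R| = 3%N by move: cR; rewrite TRkl cards2 kl add2n => -[->].
have wO m m' : T :\: R = [set m; m'] -> exists x z w', x \in S /\ word O z w' x m'.
  move=> TR.
  have [i1 Ri1] : exists i1, i1 \in R by exists i0.
  (* Three conditions; the relation of a suitable [v1] adds the missing zero at [i1]. The support of
     [C] is then within [m'] and [S], hence of size at most 3, so [C] is a word, and [m'] belongs to
     it. *)
  have [|C C0 CT] := @common_zero K _ 2 2 (m |: R :\ i1) O.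
    by have := cardsD1 i1 R; rewrite Ri1 cardsU1 cR3 add1n => -[<-];
      case: (_ \notin _).
  have Om : \tr (O m *m C) = 0 by apply: CT; rewrite !inE eqxx.
  have OR a : a \in R -> \tr (O a *m C) = 0.
    move=> Ra; have [-> | ai1] := eqVneq a i1; last first.
      by apply: CT; rewrite in_setU1 in_setD1 ai1 Ra orbT.
    have /mxtrace_mul_neq0[v1] := NT _ (subsetP RT _ Ri1); rewrite -mulmxA => v1i1.
    apply: (killed v1) => // b Rb bi1.
    by rewrite CT ?mulr0 // in_setU1 in_setD1 bi1 Rb orbT.
  have sOC : supp O C \subset m' |: S.
    apply/subsetP=> a; rewrite inE in_setU1 => Oa.
    have [//|nSa] := boolP (a \in S); first by rewrite orbT.
    have: a \in T :\: R.
      by rewrite in_setD in_setC nSa andbT; apply: contraNN Oa => /OR->.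
    by rewrite TR => /set2P[] aE; rewrite aE ?eqxx // Om eqxx in Oa *.
  have m'O : m' \in supp O C.
    rewrite inE; apply: contraNneq C0 => Om'; apply/eqP/OT => a Ta.
    have [/OR//|nRa] := boolP (a \in R).
    by have: a \in T :\: R by [rewrite in_setD nRa]; rewrite TR => /set2P[] ->.
  have [|z [w' [a [b [CE wab]]]]] :=
    word_of_small_supp (trdecomp_rot (trdecomp_rot dec)) C0.
    apply: leq_trans (subset_leq_card sOC) _.
    by rewrite cardsU1 cards2 ij; case: (_ \notin _).
  have [_ _ ab sab] := wab; rewrite -CE in sab.
  move: m'O; rewrite sab => /set2P[] m'E.
    exists b, z, w'; split; last by rewrite m'E; apply: wordC.
    have := subsetP sOC b; rewrite sab set22 => /(_ isT)/setU1P[bE|//].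
    by rewrite bE m'E eqxx in ab.
  exists a, z, w'; split; last by rewrite m'E.
  have := subsetP sOC a; rewrite sab set21 => /(_ isT)/setU1P[aE|//].
  by rewrite aE m'E eqxx in ab.
have notS a : a \in T :\: R -> a \notin [:: i; j].
  by case/setDP; rewrite in_setC !inE.
have nk : k \notin [:: i; j] by apply: notS; rewrite TRkl set21.
have nl : l \notin [:: i; j] by apply: notS; rewrite TRkl set22.
have [x [z [w1 [Sx wxl]]]] := wO _ _ TRkl.
have [y [z' [w2 [Sy wyk]]]] := wO _ _ (etrans TRkl (setUC _ _)).
have xy : x != y.
  apply: contraNneq kl => xy; rewrite xy in wxl.
  by apply/eqP/esym/(word_unique (trdecomp_rot (trdecomp_rot dec)) wxl wyk).
have [xE|xE] := set2P Sx; have [yE|yE] := set2P Sy;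
  rewrite xE yE ?eqxx // in xy wxl wyk.
  exists l, k, v; split => //; first exact: wordC.
  - by exists z, w1.
  - by exists z', w2.
exists k, l, v; split => //.
- by exists z', w2.
- by exists z, w1.
Qed.

End Chain.

(** * Entrywise formulas for 2x2 matrices *)

Section Matrix2.

Lemma big_ord2 (V : nmodType) (F : 'I_2 -> V) : \sum_i F i = F 0 + F 1.
Proof.
rewrite big_ord_recl big_ord1; congr (F _ + F _); exact: val_inj.
Qed.

Lemma ord2P (P : 'I_2 -> Prop) : P 0 -> P 1 -> forall i, P i.
Proof.
move=> P0 P1 [[|[|//]] lt_i]; first by rewrite (_ : Ordinal _ = 0) //;
  apply: val_inj.
by rewrite (_ : Ordinal _ = 1) //; apply: val_inj.
Qed.

Lemma mx22P (T : Type) (A B : 'M[T]_2) :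
  A 0 0 = B 0 0 -> A 0 1 = B 0 1 -> A 1 0 = B 1 0 -> A 1 1 = B 1 1 -> A = B.
Proof. by move=> ? ? ? ?; apply/matrixP; do 2?apply: ord2P. Qed.

Lemma mxtrace2 (R : nzRingType) (A : 'M[R]_2) : \tr A = A 0 0 + A 1 1.
Proof. exact: big_ord2. Qed.

Lemma det_mx22 (R : comNzRingType) (A : 'M[R]_2) :
  \det A = A 0 0 * A 1 1 - A 0 1 * A 1 0.
Proof.
rewrite (expand_det_row _ 0) big_ord2 /cofactor !det_mx11 !mxE /=.
have -> : lift (0 : 'I_2) (0 : 'I_1) = 1 by apply: val_inj.
have -> : lift (1 : 'I_2) (0 : 'I_1) = 0 by apply: val_inj.
by rewrite /= /bump /= expr0 expr1; ring.
Qed.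

Lemma mulmx2E (R : nzRingType) m n (A : 'M[R]_(m, 2)) (B : 'M_(2, n)) i j :
  (A *m B) i j = A i 0 * B 0 j + A i 1 * B 1 j.
Proof. by rewrite mxE big_ord2. Qed.

End Matrix2.

(** * Existence of a word *)

Section Existence.
Variable K : numFieldType.
Implicit Types M N O : 'I_7 -> 'M[K]_2.

Lemma trdecomp_sandwich M N O X Y Z :
    X \in unitmx -> Y \in unitmx -> Z \in unitmx -> trdecomp M N O ->
  trdecomp (fun i => invmx X *m M i *m Y) (fun i => invmx Z *m N i *m X)
           (fun i => invmx Y *m O i *m Z).
Proof.
move=> uX uY uZ dec A B C.
have cyc (V P W D : 'M[K]_2) : \tr (V *m P *m W *m D) = \tr (P *m (W *m D *m V)).
  by rewrite -!mulmxA mxtrace_mulC !mulmxA.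
under eq_bigr do rewrite !cyc.
rewrite dec !mulmxA !mulmxKV // mxtrace_mulC !mulmxA mulVmx // mul1mx.
by [].
Qed.

(** The polar form of the determinant: \det (X + Y) - \det X - \det Y. *)
Definition polar (X Y : 'M[K]_2) := \tr X * \tr Y - \tr (X *m Y).

Lemma det_comb2 (X Y : 'M[K]_2) x y :
  \det (x *: X + y *: Y) = x ^+ 2 * \det X + x * y * polar X Y + y ^+ 2 * \det Y.
Proof. by rewrite !det_mx22 /polar !mxtrace2 !mulmx2E !mxE; ring. Qed.

Lemma sqr_mx2 (A : 'M[K]_2) : A *m A = \tr A *: A - (\det A)%:M.
Proof.
rewrite det_mx22 mxtrace2.
by apply: mx22P; rewrite mulmx2E !mxE /= ?mulr1n ?mulr0n; ring.
Qed.

Lemma polarDl X Y Z : polar (X + Y) Z = polar X Z + polar Y Z.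
Proof. by rewrite /polar mulmxDl !raddfD /=; ring. Qed.

Lemma polarZl x X Z : polar (x *: X) Z = x * polar X Z.
Proof. by rewrite /polar -scalemxAl !mxtraceZ; ring. Qed.

Lemma polarC X Y : polar X Y = polar Y X.
Proof. by rewrite /polar mxtrace_mulC mulrC. Qed.

Section LargeSupports.
Variables (M : 'I_7 -> 'M[K]_2).
Hypothesis large : forall A, A != 0 -> (3 < #|supp M A|)%N.

Definition killed (A : 'M[K]_2) := all (fun k => \tr (M k *m A) == 0).

Lemma killed4_eq0 (s : seq 'I_7) A : uniq s -> size s = 4%N -> killed A s -> A = 0.
Proof.
move=> us s4 As; apply/eqP/negPn/negP => /large.
apply/negP; rewrite -leqNgt.
have I0 : #|[predI [in s] & [in supp M A]]| = 0%N.
  by apply: eq_card0 => k; rewrite !inE; apply/negP => /andP[/(allP As)/= ->].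
have := cardUI [in s] [in supp M A]; rewrite I0 addn0 (card_uniqP us) s4 => cU.
by have := max_card [predU [in s] & [in supp M A]]; rewrite card_ord cU.
Qed.

Lemma killed3_exists (s : seq 'I_7) : size s = 3%N -> exists2 A,
  A != 0 & killed A s.
Proof.
move=> s3; have [|A A0 As] := @common_zero K _ 2 2 [set k in s] M.
  by rewrite cardsE (leq_ltn_trans (card_size s)) ?s3.
by exists A => //; apply/allP=> k ks; rewrite As ?inE.
Qed.

(* Otherwise the determinant, as a quadratic form, vanishes on the common zeros
   of any two of the forms tr(M_i A), then on the whole space. *)
Lemma not_all_singular :
  ~ (forall s A, uniq s -> size s = 3%N -> killed A s -> \det A = 0).
Proof.
move=> sing.
pose o n (lt : (n < 7)%N) : 'I_7 := Ordinal lt.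
pose o4 := o 4%N isT; pose o5 := o 5%N isT; pose o6 := o 6%N isT.
have comb s A x B y : killed A s -> killed B s -> killed (x *: A + y *: B) s.
  move=> As Bs; apply/allP=> k ks.
  rewrite mulmxDr mxtraceD -!scalemxAr !mxtraceZ.
  by rewrite (eqP (allP As _ ks)) (eqP (allP Bs _ ks)) !mulr0 addr0.
have nz s A k : uniq (k :: s) -> size s = 3%N -> A != 0 -> killed A s ->
    \tr (M k *m A) != 0.
  move=> us s3 A0 As; apply: contraNN A0 => Mk.
  by apply/eqP/(killed4_eq0 us); rewrite /killed /= ?s3 ?Mk.
have sing2 (i j : 'I_7) A : (i < 4)%N -> (j < 4)%N -> i != j -> killed A [:: i;
  j] -> \det A = 0.
  move=> i4 j4 ij Aij.
  have un (k l : 'I_7) : (3 < k)%N -> (3 < l)%N -> k != l -> uniq [:: l; k; i; j].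
    move=> k4 l4 kl; rewrite /= !inE !negb_or eq_sym kl ij !andbT /=.
    by rewrite -!val_eqE /=; lia.
  have un3 (k : 'I_7) : (3 < k)%N -> uniq [:: k; i; j].
    by move=> k4; rewrite /= !inE negb_or ij !andbT -!val_eqE /=; lia.
  have [A4 A40 /= /and4P[k4 i4' j4' _]] := killed3_exists (erefl (size [:: o4; i;
    j])).
  have [A5 A50 /= /and4P[k5 i5' j5' _]] := killed3_exists (erefl (size [:: o5; i;
    j])).
  have [A6 A60 /= /and4P[k6 i6' j6' _]] := killed3_exists (erefl (size [:: o6; i;
    j])).
  have kA4 : killed A4 [:: i; j] by rewrite /killed /= i4' j4'.
  have kA5 : killed A5 [:: i; j] by rewrite /killed /= i5' j5'.
  have kA6 : killed A6 [:: i; j] by rewrite /killed /= i6' j6'.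
  have a54 : \tr (M o5 *m A4) != 0 by apply: (nz [:: o4; i; j]);
    rewrite ?un //= k4 i4' j4'.
  have a45 : \tr (M o4 *m A5) != 0 by apply: (nz [:: o5; i; j]);
    rewrite ?un //= k5 i5' j5'.
  have a46 : \tr (M o4 *m A6) != 0 by apply: (nz [:: o6; i; j]);
    rewrite ?un //= k6 i6' j6'.
  have a56 : \tr (M o5 *m A6) != 0 by apply: (nz [:: o6; i; j]);
    rewrite ?un //= k6 i6' j6'.
  have spanned B : killed B [:: i; j] ->
    B = (\tr (M o5 *m B) / \tr (M o5 *m A4)) *: A4 +
        (\tr (M o4 *m B) / \tr (M o4 *m A5)) *: A5.
    move=> Bij; apply/eqP; rewrite -subr_eq0; apply/eqP.
    apply: (killed4_eq0 (un o4 o5 isT isT isT)) => //.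
    set C := (X in B - X).
    have : killed (1 *: B + (-1) *: C) [:: i; j].
      by apply: (comb) => //; apply: comb.
    rewrite scale1r scaleN1r /killed /= => -> ; rewrite andbT /C.
    rewrite !mulmxBr !mulmxDr -!scalemxAr !raddfB /= !raddfD /= !mxtraceZ.
    rewrite (eqP k4) (eqP k5) !mulr0.
    by rewrite !(oppr0, addr0, add0r) !divfK // !subrr eqxx.
  have d4 : \det A4 = 0 by apply: (sing _ _ (un3 o4 isT)); rewrite //= k4 i4' j4'.
  have d5 : \det A5 = 0 by apply: (sing _ _ (un3 o5 isT)); rewrite //= k5 i5' j5'.
  have d6 : \det A6 = 0 by apply: (sing _ _ (un3 o6 isT)); rewrite //= k6 i6' j6'.
  (* Both coefficients of [A6] on [A4] and [A5] are nonzero, so its vanishing determinant isolates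
     the cross term. *)
  have p45 : polar A4 A5 = 0.
    move: d6; rewrite (spanned _ kA6) det_comb2 d4 d5 !mulr0 addr0 add0r => /eqP.
    by rewrite !mulf_eq0 !invr_eq0 (negPf a54) (negPf a45) (negPf a46) (negPf a56)
      /= => /eqP.
  by rewrite (spanned _ Aij) det_comb2 d4 d5 p45 !mulr0 !addr0.
pose o0 := o 0%N isT; pose o1 := o 1%N isT.
pose o2 := o 2%N isT; pose o3 := o 3%N isT.
have [B0 B00 /= /and4P[b01 b02 b03 _]] :=
  killed3_exists (erefl (size [:: o1; o2; o3])).
have [B1 B10 /= /and4P[b10 b12 b13 _]] :=
  killed3_exists (erefl (size [:: o0; o2; o3])).
have [B2 B20 /= /and4P[b20 b21 b23 _]] :=
  killed3_exists (erefl (size [:: o0; o1; o3])).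
have [B3 B30 /= /and4P[b30 b31 b32 _]] :=
  killed3_exists (erefl (size [:: o0; o1; o2])).
have b00 : \tr (M o0 *m B0) != 0.
  by apply: (nz [:: o1; o2; o3]); rewrite //= b01 b02 b03.
have b11 : \tr (M o1 *m B1) != 0.
  by apply: (nz [:: o0; o2; o3]); rewrite //= b10 b12 b13.
have b22 : \tr (M o2 *m B2) != 0.
  by apply: (nz [:: o0; o1; o3]); rewrite //= b20 b21 b23.
have b33 : \tr (M o3 *m B3) != 0.
  by apply: (nz [:: o0; o1; o2]); rewrite //= b30 b31 b32.
have one : 1%:M =
    (\tr (M o0) / \tr (M o0 *m B0)) *: B0 + (\tr (M o1) / \tr (M o1 *m B1)) *: B1 +
    (\tr (M o2) / \tr (M o2 *m B2)) *: B2 + (\tr (M o3) / \tr (M o3 *m B3)) *: B3.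
  apply/eqP; rewrite -subr_eq0; apply/eqP.
  apply: (@killed4_eq0 [:: o0; o1; o2; o3]) => //.
  rewrite /killed /= !mulmxBr !mulmxDr -!scalemxAr !mulmx1 !raddfB /= !raddfD /=
    !mxtraceZ.
  rewrite (eqP b01) (eqP b02) (eqP b03) (eqP b10) (eqP b12) (eqP b13).
  rewrite (eqP b20) (eqP b21) (eqP b23) (eqP b30) (eqP b31) (eqP b32).
  by rewrite !mulr0 !(oppr0, addr0, add0r) !divfK // !subrr eqxx.
have bE := (b01, b02, b03, b10, b12, b13, b20, b21, b23, b30, b31, b32).
(* Each of [B0], ..., [B3] is killed by three of the first four forms, so any two of them share two
   killed forms. The determinant vanishes on that common plane, and so does its polar form. *)
have pol (i j : 'I_7) A B : (i < 4)%N -> (j < 4)%N -> i != j ->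
    killed A [:: i; j] -> killed B [:: i; j] -> polar A B = 0.
  move=> i4 j4 ij kA kB; have kAB := comb _ _ 1 _ 1 kA kB.
  move: (sing2 _ _ _ i4 j4 ij kAB); rewrite det_comb2.
  by rewrite (sing2 _ _ _ i4 j4 ij kA) (sing2 _ _ _ i4 j4 ij kB) !mulr0 addr0 add0r
    !mul1r.
have p00 : polar B0 B0 = 0 by apply: (pol o1 o2); rewrite // /killed /= ?bE.
have p01 : polar B0 B1 = 0 by apply: (pol o2 o3); rewrite // /killed /= ?bE.
have p02 : polar B0 B2 = 0 by apply: (pol o1 o3); rewrite // /killed /= ?bE.
have p03 : polar B0 B3 = 0 by apply: (pol o1 o2); rewrite // /killed /= ?bE.
have p11 : polar B1 B1 = 0 by apply: (pol o0 o2); rewrite // /killed /= ?bE.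
have p12 : polar B1 B2 = 0 by apply: (pol o0 o3); rewrite // /killed /= ?bE.
have p13 : polar B1 B3 = 0 by apply: (pol o0 o2); rewrite // /killed /= ?bE.
have p22 : polar B2 B2 = 0 by apply: (pol o0 o1); rewrite // /killed /= ?bE.
have p23 : polar B2 B3 = 0 by apply: (pol o0 o1); rewrite // /killed /= ?bE.
have p33 : polar B3 B3 = 0 by apply: (pol o0 o1); rewrite // /killed /= ?bE.
(* Its actual value is 2 * 2 - 2 = 2. *)
have : polar 1%:M 1%:M = 0.
  rewrite {1}one !polarDl !polarZl 4![polar _ 1%:M]polarC one !polarDl !polarZl.
  rewrite !(polarC B1 B0) !(polarC B2 B0) !(polarC B3 B0) !(polarC B2 B1)
    !(polarC B3 B1) !(polarC B3 B2).
  by rewrite p00 p01 p02 p03 p11 p12 p13 p22 p23 p33 !mulr0 !addr0 !mulr0 !addr0.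
rewrite /polar mulmx1 mxtrace1 -natrM -natrB // => /eqP.
by rewrite pnatr_eq0.
Qed.

End LargeSupports.

(* Outside Z the N_i and the O_i are dual bases for the trace form.  In them
   left multiplication by A, if A is killed by Z minus z, is a diagonal matrix
   plus a matrix f g of rank 1; it satisfies the characteristic equation of A,
   of degree 2, although the four diagonal entries are distinct.  This forces
   a zero in g, that is an O_j in which N has support of size at most 3. *)
Lemma not_all_large_centered M N O (Z : {set 'I_7}) : trdecomp M N O ->
    (forall A, A != 0 -> (3 < #|supp M A|)%N) ->
    (forall B, B != 0 -> (3 < #|supp N B|)%N) ->
  #|Z| = 3%N -> (forall k, k \in Z -> \tr (M k) = 0) -> False.
Proof.
move=> dec largeM largeN cZ MZ; pose S := ~: Z; pose m k := \tr (M k).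
have cS : #|S| = 4%N by have := cardsC Z; rewrite cZ card_ord -/S !addSn => -[].
have mS k : k \in S -> m k != 0.
  suff /eqP <- : supp M 1%:M == S by rewrite inE mulmx1.
  rewrite eqEcard cS largeM ?oner_neq0 // andbT; apply/subsetP => l.
  by rewrite !inE mulmx1; apply: contraNN => /MZ->.
have duality B C : \tr (B *m C) =
    \sum_(k in S) m k * \tr (N k *m B) * \tr (O k *m C).
  rewrite -[B]mul1mx -dec [LHS](bigID [in S]) /= [X in _ + X]big1 ?addr0.
    by apply: eq_bigr => k _; rewrite mulmx1 mul1mx.
  by move=> k; rewrite inE negbK => /MZ; rewrite mulmx1 => ->; rewrite !mul0r.
have expand B : B = \sum_(k in S) (m k * \tr (N k *m B)) *: O k.
  apply/eqP; rewrite -subr_eq0; apply/eqP/mxtrace_mul_eq0 => C.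
  rewrite mulmxBl mulmx_suml raddfB /= [X in _ - X]raddf_sum /= duality -sumrB big1
    // => k _.
  by rewrite -scalemxAl mxtraceZ subrr.
have dual i : i \in S ->
    [/\ O i != 0, m i * \tr (N i *m O i) = 1 &
     forall k, k \in S -> k != i -> \tr (N k *m O i) = 0].
  move=> Si; have [|B B0 BS] := @common_zero K _ 2 2 (S :\ i) N.
    by have := cardsD1 i S; rewrite Si cS add1n => -[<-].
  have BO : B = (m i * \tr (N i *m B)) *: O i.
    rewrite {1}[B]expand (bigD1 i) //= [X in _ + X]big1 ?addr0 // => k /andP[Sk ki].
    by rewrite BS ?mulr0 ?scale0r // in_setD1 ki.
  have c0 : m i * \tr (N i *m B) != 0.
    by apply: contraNneq B0 => c0; rewrite BO c0 scale0r.
  have O0 : O i != 0 by apply: contraNneq B0 => O0; rewrite BO O0 scaler0.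
  have NO k : k \in S -> k != i -> \tr (N k *m O i) = 0.
    move=> Sk ki; have /eqP : \tr (N k *m B) = 0 by rewrite BS // in_setD1 ki.
    by rewrite BO -scalemxAr mxtraceZ mulf_eq0 (negPf c0) => /eqP.
  split=> //; apply/eqP; rewrite -subr_eq0.
  suff /eqP : (m i * \tr (N i *m O i) - 1) *: O i = 0.
    by rewrite scaler_eq0 (negPf O0) orbF.
  rewrite scalerBl scale1r [X in _ - X]expand (bigD1 i) //= big1 ?addr0 ?subrr //
    => k /andP[Sk ki].
  by rewrite NO ?mulr0 ?scale0r.
have /card_gt0P[z Zz] : (0 < #|Z|)%N by rewrite cZ.
have nzO j : j \in S -> \tr (N z *m O j) != 0.
  move=> Sj; have [O0 _ NO] := dual _ Sj.
  apply: contraTN (largeN _ O0) => /eqP Nz; rewrite -leqNgt.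
  have sub : supp N (O j) \subset j |: Z :\ z.
    apply/subsetP=> k; rewrite inE in_setU1 in_setD1 => Nk.
    have [//|kj] := eqVneq k j; have [kz|kz] := eqVneq k z.
      by rewrite kz Nz eqxx in Nk.
    by have [//|nZk] := boolP (k \in Z); rewrite NO ?in_setC ?eqxx in Nk.
  apply: leq_trans (subset_leq_card sub) _; rewrite cardsU1.
  have := cardsD1 z Z; rewrite Zz cZ add1n => -[<-].
  by case: (_ \notin _).
have /card_gt0P[s Ss] : (0 < #|S|)%N by rewrite cS.
(* Three conditions; the one at [s] prevents [A] from being scalar, as [m s] is nonzero. *)
have [|A A0 AZ] := @common_zero K _ 2 2 (s |: Z :\ z) M.
  rewrite cardsU1; have := cardsD1 z Z; rewrite Zz cZ add1n => -[<-].
  by case: (_ \notin _).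
have As : \tr (M s *m A) = 0 by apply: AZ; rewrite setU11.
have AZz k : k \in Z -> k != z -> \tr (M k *m A) = 0.
  by move=> Zk kz; apply: AZ; rewrite in_setU1 in_setD1 kz Zk orbT.
pose d k := \tr (M k *m A) / m k.
have d_inj i j : i \in S -> j \in S -> i != j -> d i != d j.
  move=> Si Sj ij; apply/eqP => dij.
  have AE : A - d i *: 1%:M = 0.
    apply/eqP/negPn/negP => /largeM; apply/negP; rewrite -leqNgt.
    have sub : supp M (A - d i *: 1%:M) \subset z |: S :\ i :\ j.
      apply/subsetP=> k; rewrite inE in_setU1 !in_setD1 mulmxBr -scalemxAr mulmx1.
      rewrite raddfB /= mxtraceZ => Mk.
      have [//|kz] := eqVneq k z.
      have Sk : k \in S.
        by rewrite in_setC; apply: contraNN Mk => Zk;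
          rewrite AZz // MZ // mulr0 subr0.
      rewrite Sk andbT /=; apply/andP; split; apply: contraNneq Mk => ->.
        by rewrite dij divfK ?mS // subrr.
      by rewrite divfK ?mS // subrr.
    apply: leq_trans (subset_leq_card sub) _; rewrite cardsU1.
    have := cardsD1 i S; rewrite Si cS add1n => -[e].
    have := cardsD1 j (S :\ i); rewrite in_setD1 eq_sym ij Sj -e add1n => -[<-].
    by case: (_ \notin _).
  have {}AE : A = d i *: 1%:M by apply/eqP; rewrite -subr_eq0 AE.
  move: As; rewrite AE -scalemxAr mulmx1 mxtraceZ => /eqP.
  rewrite mulf_eq0 (negPf (mS _ Ss)) orbF => /eqP di.
  by move: A0; rewrite AE di scale0r eqxx.
pose g j := \tr (M z *m A) * \tr (N z *m O j).
pose f i := \tr (O z *m N i).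
have T i j : i \in S -> j \in S ->
    \tr (A *m O j *m N i) = (i == j)%:R * (d j / m j) + f i * g j.
  move=> Si Sj; rewrite -dec (bigD1 z) //= addrC; congr (_ + _); last first.
    by rewrite /f /g; ring.
  have [_ mN NO] := dual _ Sj.
  rewrite (bigD1 j) //=; last by apply: contraTneq Sj => ->; rewrite in_setC Zz.
  rewrite big1 ?addr0 => [|k /andP[kz kj]]; last first.
    have [/AZz->//|nZk] := boolP (k \in Z); first by rewrite !mul0r.
    by rewrite NO ?in_setC // mulr0 mul0r.
  rewrite [\tr (O j *m _)]mxtrace_mulC.
  have [->|ij] := eqVneq i j; last by rewrite (NO i) // mulr0 !mul0r.
  have -> : \tr (N j *m O j) = (m j)^-1.
    by apply: (mulfI (mS _ Sj)); rewrite mN divff ?mS.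
  by rewrite mul1r.
pose gam := \sum_(k in S) m k * f k * g k.
have sumS i (F : 'I_7 -> K) : i \in S -> \sum_(k in S) (k == i)%:R * F k = F i.
  move=> Si; rewrite (bigD1 i) //= eqxx mul1r big1 ?addr0 // => k /andP[_ /negPf->].
  by rewrite mul0r.
(* The entries of the Cayley-Hamilton equation in the dual bases. *)
have quad i j : i \in S -> j \in S ->
    m j * (i == j)%:R * (d j / m j) ^+ 2 + f i * g j * (d i + d j + gam) =
    \tr A * ((i == j)%:R * (d j / m j) + f i * g j) - \det A * ((i == j)%:R / m j).
  move=> Si Sj; have mj := mS _ Sj; have mi := mS _ Si.
  have NO : \tr (O j *m N i) = (i == j)%:R / m j.
    have [_ mN NO] := dual _ Sj; rewrite mxtrace_mulC.
    have [->|ij] := eqVneq i j; last by rewrite NO // mul0r.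
    by apply: (mulfI mj); rewrite mN mul1r divff.
  transitivity (\tr (A *m A *m O j *m N i)); last first.
    rewrite sqr_mx2 !mulmxBl -!scalemxAl mul_scalar_mx -scalemxAl.
    by rewrite raddfB /= !mxtraceZ T // NO.
  rewrite -[A *m A *m O j]mulmxA [A *m O j]expand mulmx_sumr mulmx_suml raddf_sum
    /=.
  rewrite [RHS](eq_bigr (fun k =>
    (k == j)%:R * (m k * (d j / m j) * ((i == k)%:R * (d k / m k) + f i * g k)) +
    ((k == i)%:R * (f k * g j * d k) + f i * g j * (m k * f k * g k)))).
    rewrite !big_split /= !sumS // -big_distrr /= -/gam; by field; rewrite ?mi ?mj.
  move=> k Sk; rewrite -scalemxAr -scalemxAl mxtraceZ T //.
  rewrite [\tr (N k *m _)]mxtrace_mulC T //.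
  have mk := mS _ Sk; rewrite [i == k]eq_sym.
  by have [->|ki] := eqVneq k i; field; rewrite ?mi ?mj ?mk.
(* If some [f i] is nonzero, the off-diagonal entries of row [i] can be divided by [f i * g j] and
   determine [d j]. If [f] vanishes on [S], every [d j] is a root of the characteristic polynomial,
   which leaves one value besides [d s]. Either way three distinct numbers would coincide. *)
have [i Si const] : exists2 i, i \in S &
    forall j k, j \in S -> k \in S -> j != i -> k != i -> d j = d k.
  have [/existsP[i /andP[Si fi]] | /existsPn f0] :=
    boolP [exists i, (i \in S) && (f i != 0)].
    have off j : j \in S -> j != i -> d j = \tr A - gam - d i.
      move=> Sj ji; have := quad i j Si Sj.
      rewrite eq_sym (negPf ji) !(mulr0, mul0r) subr0 !add0r [RHS]mulrC => /mulfI H.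
      have az : \tr (M z *m A) != 0.
        apply: contraTneq (largeM _ A0) => Mz; rewrite -leqNgt.
        have sub : supp M A \subset S :\ s.
          apply/subsetP=> k; rewrite inE in_setD1 in_setC => Mk; apply/andP; split.
            by apply: contraNneq Mk => ->; rewrite As.
          apply: contraNN Mk => Zk; have [->|kz] := eqVneq k z; first by rewrite Mz.
          by rewrite AZz.
        apply: leq_trans (subset_leq_card sub) _.
        by have := cardsD1 s S; rewrite Ss cS add1n => -[<-].
      have -> : \tr A = d i + d j + gam by apply/esym/H;
        rewrite mulf_neq0 ?fi ?mulf_neq0 ?nzO.
      by ring.
    by exists i => // j k Sj Sk ji ki; rewrite (off j) // (off k).
  have diag j : j \in S -> d j ^+ 2 = \tr A * d j - \det A.
    move=> Sj; have mj := mS _ Sj; have := quad j j Sj Sj.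
    have /negPn/eqP -> : ~~ (f j != 0) by have := f0 j; rewrite Sj.
    rewrite eqxx !mul0r !addr0 => H.
    transitivity (m j * (m j * 1 * (d j / m j) ^+ 2)); first by field.
    by rewrite H /=; field.
  exists s => // j k Sj Sk js ks.
  have sum l : l \in S -> l != s -> d l = \tr A - d s.
    move=> Sl ls; apply: (addIr (d s)); apply: (@mulfI _ (d l - d s)).
      by rewrite subr_eq0 d_inj.
    rewrite subrK -subr_sqr diag // diag //; ring.
  by rewrite (sum j) // (sum k).
have c3 : #|S :\ i| = 3%N by have := cardsD1 i S; rewrite Si cS add1n => -[<-].
have /card_gt0P[j Sij] : (0 < #|S :\ i|)%N by rewrite c3.
have /card_gt0P[k Sijk] : (0 < #|S :\ i :\ j|)%N.
  by have := cardsD1 j (S :\ i); rewrite Sij c3 add1n => -[<-].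
move: Sij Sijk; rewrite !in_setD1 => /andP[ji Sj] /and3P[kj ki Sk].
by have := d_inj _ _ Sk Sj kj; rewrite (const k j) // eqxx.
Qed.

(** Replacing [M i] by [M i *m A], for an invertible [A] killed by three of the forms, gives three
    factors trace 0 and preserves the hypotheses on supports. *)
Lemma not_all_large M N O : trdecomp M N O ->
    (forall A, A != 0 -> (3 < #|supp M A|)%N) ->
  (forall B, B != 0 -> (3 < #|supp N B|)%N) -> False.
Proof.
move=> dec largeM largeN; apply: (not_all_singular largeM) => s A us s3 As.
apply/eqP/negPn/negP; rewrite -unitfE -unitmxE => uA.
have u1 : 1%:M \in @unitmx K 2 by apply: unitmx1.
have dec' := trdecomp_sandwich u1 uA u1 dec.
apply: (@not_all_large_centered _ _ _ [set k in s] dec').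
- move=> B B0; have AB0 : A *m B != 0.
    by apply: contraNneq B0 => AB; rewrite -[B](mulKmx uA) AB mulmx0.
  rewrite (leq_trans (largeM _ AB0)) //; apply/subset_leq_card/subsetP => k.
  by rewrite !inE invmx1 mul1mx mulmxA.
- by move=> B /largeN; congr (_ < _)%N; apply: eq_card => k;
  rewrite !inE invmx1 mul1mx mulmx1.
- by rewrite cardsE (card_uniqP us).
- by move=> k; rewrite inE invmx1 mul1mx => /(allP As)/eqP.
Qed.

End Existence.

Lemma uniq_ord_size n (s : seq 'I_n) : uniq s -> (size s <= n)%N.
Proof. by move/card_uniqP=> <-; apply: leq_trans (max_card _) _;
  rewrite card_ord. Qed.

(** * The hexagon of words *)

Section Triads.
Variable K : fieldType.
Implicit Types M N O : 'I_7 -> 'M[K]_2.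

Lemma exists_col_factor (t : 'rV[K]_2) (x : 'cV_2) n (X : 'M_(2, n)) :
  t != 0 -> x != 0 -> t *m x = 0 -> t *m X = 0 -> exists y, X = x *m y.
Proof.
move=> t0 x0 tx tX; have [s sx] := exists_mul_eq1 x0; exists (s *m X).
apply/eqP; rewrite -subr_eq0; apply/eqP/cols_mul_eq0 => q.
have tD : t *m ((X - x *m (s *m X)) *m q) = 0.
  by rewrite mulmxA mulmxBr tX [t *m (x *m _)]mulmxA tx mul0mx subr0 mul0mx.
have [a Da] := orthogonal_cols_parallel t0 x0 tx tD.
have : s *m ((X - x *m (s *m X)) *m q) = 0.
  by rewrite mulmxA mulmxBr [s *m (x *m _)]mulmxA sx mul1mx subrr mul0mx.
rewrite Da -scalemxAr sx scalemx1 => /(congr1 mxtrace).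
by rewrite mxtrace_scalar mxtrace0 mulr1n => ->; rewrite scale0r.
Qed.

Lemma dyad_trace_eq0 (X : 'M[K]_2) (u : 'cV_2) (p : 'rV_2) :
  \tr (X *m (u *m p)) = 0 -> p *m X *m u = 0.
Proof.
rewrite mulmxA mxtrace_mulC mulmxA trace_mx11 => pXu.
by apply/matrixP => i j; rewrite !ord1 pXu mxE.
Qed.

Lemma word_outside M u p i j k : word M u p i j -> k != i -> k != j ->
  p *m M k *m u = 0.
Proof.
move=> [_ _ _ s] ki kj; apply: dyad_trace_eq0; apply/eqP/negPn/negP.
by move=> Mk; have := in_set2 k i j; rewrite -s inE Mk (negPf ki) (negPf kj).
Qed.

(* For Strassen's algorithm the six products whose factors all have rank 1
   are indexed by the permutations (a, b, c) of {0, 1, 2}, with factors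
   proportional to x_b u_c^perp, z_c x_a^perp and u_a z_b^perp; the k-th
   triad collects what these say about x_k, z_k and u_k. *)
Definition triad M N O (a b c : seq 'I_7) e (x z u : 'cV[K]_2) :=
  [/\ [/\ x != 0, z != 0 & u != 0],
      forall i, i \in a -> N i *m x = 0 /\ exists y, O i = u *m y,
      forall i, i \in b -> O i *m z = 0 /\ exists y, M i = x *m y,
      forall i, i \in c -> M i *m u = 0 /\ exists y, N i = z *m y &
      [/\ exists k, M e *m u = k *: x, exists k, N e *m x = k *: z &
          exists k, O e *m z = k *: u]].

Lemma word_triad M N O u p q v a a' b b' z' w c c' e : trdecomp M N O ->
    word M u p a a' -> word N q v b b' -> word O z' w c c' -> p *m q = 0 ->
    uniq [:: a; a'; b; b'; c; c'; e] ->
  exists x z u, triad M N O [:: a; a'] [:: b; b'] [:: c; c'] e x z u.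
Proof.
move=> dec wM wN wO pq un.
have dec1 := trdecomp_rot dec; have dec2 := trdecomp_rot dec1.
have [u0 p0 _ _] := wM; have [q0 v0 _ _] := wN; have [z'0 w0 _ _] := wO.
have [z z0 vz] := exists_orthogonal_col v.
have [t t0 tu] := exists_orthogonal_row u.
have [t' t'0 t'z'] := exists_orthogonal_row z'.
have [s s0 ws] := exists_orthogonal_col w.
move: un; rewrite /= !inE !negb_or.
rewrite -!andbA.
case/andP=> aa'; case/andP=> ab; case/andP=> ab'; case/andP=> ac; case/andP=> ac'.
case/andP=> ae; case/andP=> a'b; case/andP=> a'b'; case/andP=> a'c;
  case/andP=> a'c'.
case/andP=> a'e; case/andP=> bb'; case/andP=> bc; case/andP=> bc'; case/andP=> be.
case/andP=> b'c; case/andP=> b'c'; case/andP=> b'e; case/andP=> cc'; case/andP=> ce.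
case/andP=> c'e _.
have Na i : i \in [:: a; a'] -> N i *m q = 0.
  rewrite !inE => /orP[]/eqP->; apply/eqP; first
    by rewrite (word_col_kernel dec wM) pq.
  by rewrite (word_col_kernel dec (wordC wM)) pq.
have Mb i : i \in [:: b; b'] -> p *m M i = 0.
  rewrite !inE => /orP[]/eqP->; apply/eqP; first
    by rewrite (word_row_kernel dec1 wN) pq.
  by rewrite (word_row_kernel dec1 (wordC wN)) pq.
have wkc i : i \in [:: c; c'] ->
    (forall r : 'cV_2, (M i *m r == 0) = (w *m r == 0)) /\
    (forall r : 'rV_2, (r *m N i == 0) = (r *m z' == 0)).
  rewrite !inE => /orP[]/eqP->; split=> r.
  - exact: (word_col_kernel dec2 wO).
  - exact: (word_row_kernel dec2 wO).
  - exact: (word_col_kernel dec2 (wordC wO)).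
  - exact: (word_row_kernel dec2 (wordC wO)).
have wu : w *m u = 0.
  have pMc : p *m M c != 0.
    apply/eqP => pMc.
    have := kill_row_uniq dec p0 (Mb b (mem_head _ _)) (Mb b' (mem_last b [:: b']))
      pMc.
    by rewrite /= !inE negb_or bb' b'c bc.
  have pMcu : p *m M c *m u = 0 by apply: (word_outside wM); rewrite eq_sym.
  have Mcs : M c *m s = 0 by apply/eqP; rewrite (wkc c (mem_head _ _)).1 ws.
  have pMcs : p *m M c *m s = 0 by rewrite -mulmxA Mcs mulmx0.
  have [k ->] := orthogonal_rows_parallel s0 pMc pMcs ws.
  by rewrite -scalemxAl pMcu scaler0.
have vz' : v *m z' = 0.
  have Ncq : N c *m q != 0.
    apply/eqP => Ncq.
    have := kill_col_uniq dec1 q0 (Na a (mem_head _ _)) (Na a' (mem_last a [::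
      a'])) Ncq.
    by rewrite /= !inE negb_or aa' ac a'c.
  have vNcq : v *m N c *m q = 0 by apply: (word_outside wN); rewrite eq_sym.
  have t'Nc : t' *m N c = 0 by apply/eqP; rewrite (wkc c (mem_head _ _)).2 t'z'.
  have [k ->] : exists k, v = k *: t'.
    by apply: (@orthogonal_rows_parallel _ (N c *m q));
      rewrite // mulmxA ?t'Nc ?mul0mx.
  by rewrite -scalemxAl t'z' scaler0.
exists q, z, u; split => //.
- move=> i ai; split; first exact: Na.
  apply: (exists_col_factor t0 u0 tu); apply/eqP.
  move: ai; rewrite !inE => /orP[]/eqP->.
    by rewrite (word_row_kernel dec wM) tu.
  by rewrite (word_row_kernel dec (wordC wM)) tu.
- move=> i bi; split; last exact: exists_col_factor p0 q0 pq (Mb _ bi).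
  apply/eqP; move: bi; rewrite !inE => /orP[]/eqP->.
    by rewrite (word_col_kernel dec1 wN) vz.
  by rewrite (word_col_kernel dec1 (wordC wN)) vz.
- move=> i ci; split; first by apply/eqP; rewrite (wkc i ci).1 wu.
  by apply: (exists_col_factor v0 z0 vz); apply/eqP; rewrite (wkc i ci).2 vz'.
have Oez : w *m (O e *m z) = 0.
  have [k ->] := orthogonal_cols_parallel v0 z'0 vz' vz.
  by rewrite -!scalemxAr mulmxA (word_outside wO) ?scaler0 // eq_sym.
split.
- apply: (orthogonal_cols_parallel p0 q0 pq).
  by rewrite mulmxA (word_outside wM) // eq_sym.
- apply: (orthogonal_cols_parallel v0 z0 vz).
  by rewrite mulmxA (word_outside wN) // eq_sym.
exact: (orthogonal_cols_parallel w0 u0 wu).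
Qed.

Lemma word_tr M u p i j :
  word (fun k => (M k)^T) p^T u^T i j <-> word M u p i j.
Proof.
have s : supp (fun k => (M k)^T) (p^T *m u^T) = supp M (u *m p).
  by apply/setP=> k; rewrite !inE -trmx_mul -trmx_mul mxtrace_tr mxtrace_mulC.
by rewrite /word !trmx_eq0 s; split=> -[? ? ? ?]; split.
Qed.

Definition linked M i j := exists u p, word M u p i j.

Lemma linkedC M i j : linked M i j -> linked M j i.
Proof. by case=> u [p /wordC w]; exists u, p. Qed.

Lemma linked_unique M N O i j k : trdecomp M N O -> linked M i j -> linked M i k ->
  j = k.
Proof. by move=> dec [u [p w]] [u' [p' w']]; apply: word_unique dec w w'. Qed.

Lemma linked_neq M i j : linked M i j -> i != j.
Proof. by case=> u [p []]. Qed.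

(** The word for [N] gives [O i] and [O j] a common kernel, which the word for [M] excludes. *)
Lemma linked_not_both M N O i j : trdecomp M N O -> linked M i j -> linked N i j ->
  False.
Proof.
move=> dec [u [p wM]] [q [v wN]]; have [_ v0 _ _] := wN.
have [r r0 vr] := exists_orthogonal_col v; case/eqP: r0.
have dec1 := trdecomp_rot dec.
apply: (word_dual_independent dec wM); apply/eqP.
  by rewrite (word_col_kernel dec1 wN) vr.
by rewrite (word_col_kernel dec1 (wordC wN)) vr.
Qed.

(** Transposition exchanges the roles of [M] and [O] in the chain. *)
Lemma linked_chain_tr M N O i j : trdecomp M N O -> linked O i j ->
  exists k l, [/\ [/\ k != i, k != j, l != i & l != j],
    linked M i k & linked M j l].
Proof.
move=> dec [z [w wO]]; move/word_tr: (wO) => wO'.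
have [_ z0 _ _] := wO'; have [q q0 zq] := exists_orthogonal_col z^T.
have [k [l [v [_ ki lj [u [p w1]] [u' [p' w2]]]]]] :=
  word_chain (trdecomp_tr dec) wO' q0 zq.
exists k, l; move: ki lj; rewrite !inE !negb_or => /andP[? ?] /andP[? ?];
  split=> //.
  by exists p^T, u^T; apply/word_tr; rewrite !trmxK.
by exists p'^T, u'^T; apply/word_tr; rewrite !trmxK.
Qed.

Lemma linked_chain M N O i j : trdecomp M N O -> linked M i j ->
  exists k l, [/\ [/\ k != i, k != j, l != i & l != j], linked O i k, linked O j l &
    exists u p q v, [/\ word M u p i j, word N q v k l & p *m q = 0]].
Proof.
move=> dec [u [p w]]; have [q q0 pq] := exists_orthogonal_col p.
have [k [l [v [wN ki lj O1 O2]]]] := word_chain dec w q0 pq.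
exists k, l; move: ki lj; rewrite !inE !negb_or => /andP[? ?] /andP[? ?];
  split=> //.
by exists u, p, q, v.
Qed.

(* In the cyclic order i1 i2 i4 i6 i5 i3 words for M and for O alternate on the
   sides of the hexagon, and the words for N join opposite vertices. *)
Lemma hexagon M N O i1 i2 : trdecomp M N O -> linked M i1 i2 ->
  exists i3 i4 i5 i6 i7, [/\ uniq [:: i1; i2; i3; i4; i5; i6; i7],
    exists x z u, triad M N O [:: i1; i2] [:: i3; i4] [:: i5; i6] i7 x z u,
    exists x z u, triad M N O [:: i3; i5] [:: i1; i6] [:: i2; i4] i7 x z u &
    exists x z u, triad M N O [:: i4; i6] [:: i2; i5] [:: i1; i3] i7 x z u].
Proof.
move=> dec M12; have dec1 := trdecomp_rot dec; have dec2 := trdecomp_rot dec1.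
have uM i j k := @linked_unique M N O i j k dec.
have uO i j k := @linked_unique O M N i j k dec2.
have [i3 [i4 [[n31 n32 n41 n42] O13 O24 [u [p [q [v [w12 w34 pq]]]]]]]] :=
  linked_chain dec M12.
have n12 := linked_neq M12.
have N34 : linked N i3 i4 by exists q, v.
have n34 := linked_neq N34.
have [k [i5 [[_ _ n51 n53] M1k M35]]] := linked_chain_tr dec O13.
have {k M1k} _ := uM _ _ _ M1k M12.
have n52 : i5 != i2.
  apply: contraNneq n31 => e; rewrite e in M35.
  by apply/eqP; apply: uM (linkedC M35) (linkedC M12).
have n54 : i5 != i4.
  by apply/eqP => e; rewrite e in M35; apply: linked_not_both dec M35 N34.
have [k [i6 [[_ _ n62 n64] M2k M46]]] := linked_chain_tr dec O24.
have {k M2k} _ := uM _ _ _ M2k (linkedC M12).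
have n61 : i6 != i1.
  apply: contraNneq n42 => e; rewrite e in M46.
  by apply/eqP; apply: uM (linkedC M46) M12.
have n63 : i6 != i3.
  by apply/eqP => e; rewrite e in M46; apply: linked_not_both dec (linkedC M46) N34.
have n65 : i6 != i5.
  apply: contraNneq n34 => e; rewrite e in M46.
  by apply/eqP; apply: uM (linkedC M35) (linkedC M46).
have un6 : uniq [:: i1; i2; i3; i4; i5; i6].
  rewrite /= !inE !negb_or n12 n34.
  rewrite (eq_sym i1 i3) (eq_sym i1 i4) (eq_sym i1 i5) (eq_sym i1 i6) (eq_sym i2
    i3) (eq_sym i2 i4) (eq_sym i2 i5) (eq_sym i2 i6) (eq_sym i3 i5) (eq_sym i3 i6)
      (eq_sym i4 i5) (eq_sym i4 i6) (eq_sym i5 i6).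
  by rewrite n31 n41 n51 n61 n32 n42 n52 n62 n53 n63 n54 n64 n65.
have [k [l [[_ _ l3 l5] O3k O5l [u' [p' [q' [v' [w35 w1l pq']]]]]]]] :=
  linked_chain dec M35.
have ek := uO _ _ _ O3k (linkedC O13); rewrite {k O3k}ek in w1l.
have [k [l' [[_ _ l'4 l'6] O4k O6l' [u'' [p'' [q'' [v'' [w46 w2l' pq'']]]]]]]] :=
  linked_chain dec M46.
have ek := uO _ _ _ O4k (linkedC O24); rewrite {k O4k}ek in w2l'.
have l1 : l != i1 by case: w1l => _ _; rewrite eq_sym.
have l'2 : l' != i2 by case: w2l' => _ _; rewrite eq_sym.
have l2 : l != i2.
  apply: contraNneq n54 => e; rewrite e in O5l.
  by apply/eqP; apply: uO (linkedC O5l) O24.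
have l4 : l != i4.
  apply: contraNneq n52 => e; rewrite e in O5l.
  by apply/eqP; apply: uO (linkedC O5l) (linkedC O24).
have l'1 : l' != i1.
  apply: contraNneq n63 => e; rewrite e in O6l'.
  by apply/eqP; apply: uO (linkedC O6l') O13.
have l'3 : l' != i3.
  apply: contraNneq n61 => e; rewrite e in O6l'.
  by apply/eqP; apply: uO (linkedC O6l') (linkedC O13).
(* Pigeonhole: if the sides leaving [i5] and [i6] did not meet, then [l], [l'] and the six indices
   found so far would be eight distinct elements of ['I_7]. *)
have l6 : l = i6.
  have [//|l6] := eqVneq l i6.
  have [l'5|l'5] := eqVneq l' i5.
    by rewrite l'5 in O6l'; apply: uO O5l (linkedC O6l').
  have [ll'|ll'] := eqVneq l l'.
    rewrite -ll' in O6l'; have e := uO _ _ _ (linkedC O5l) (linkedC O6l').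
    by rewrite e eqxx in n65.
  suff /uniq_ord_size : uniq [:: l; l'; i1; i2; i3; i4; i5; i6] by [].
  rewrite cons_uniq cons_uniq un6 !inE !negb_or ll' l1 l2 l3 l4 l5 l6.
  by rewrite l'1 l'2 l'3 l'4 l'5 l'6.
rewrite l6 in w1l O5l.
have l'5 := uO _ _ _ O6l' (linkedC O5l); rewrite l'5 in w2l'.
have [i7 n7] : exists i7, i7 \notin [:: i1; i2; i3; i4; i5; i6].
  apply/existsP; rewrite -negb_forall; apply/negP => /forallP all6.
  have : (#|'I_7| <= #|[:: i1; i2; i3; i4; i5;
    i6]|)%N by apply/subset_leq_card/subsetP.
  by rewrite card_ord (card_uniqP un6).
have un7 : uniq [:: i1; i2; i3; i4; i5; i6; i7].
  by rewrite -(cat1s i7 [::]) -[_ :: _]/([:: i1; i2; i3; i4; i5;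
    i6] ++ [:: i7]) cat_uniq un6 /= orbF andbT.
have [z [w w56]] := O5l; have [z' [w' w24]] := O24; have [z'' [w'' w13]] := O13.
exists i3, i4, i5, i6, i7; split=> //.
- exact: (word_triad dec w12 w34 w56).
- apply: (word_triad dec w35 w1l w24) => //.
  (* Two lists are permutations of each other when every predicate has equal counts in them, which
     here is commutativity of addition. *)
  by apply: etrans un7; apply: perm_uniq; apply/seq.permP => P /=; ring.
- apply: (word_triad dec w46 w2l' w13) => //.
  by apply: etrans un7; apply: perm_uniq; apply/seq.permP => P /=; ring.
Qed.

End Triads.

(** * Normal form *)

Section NormalForm.
Variable K : numFieldType.
Implicit Types M N O : 'I_7 -> 'M[K]_2.

Definition col2 (a b : K) : 'cV[K]_2 := \col_i (if i == 0 then a else b).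
Definition row2 (a b : K) : 'rV[K]_2 := \row_i (if i == 0 then a else b).

(* Any value k >= 2 stands for the third vector. *)
Definition stdcol k := nth (col2 1 1) [:: col2 1 0; col2 0 1] k.
(** Chosen so that [stdrow k] spans the annihilator of [stdcol k]. *)
Definition stdrow k := nth (row2 1 (-1)) [:: row2 0 1; row2 1 0] k.

Lemma col2E (x : 'cV[K]_2) : x = col2 (x 0 0) (x 1 0).
Proof. by apply/colP; apply: ord2P; rewrite !mxE. Qed.

Lemma mulmx_col2 (X : 'M[K]_2) a b : X *m col2 a b = a *: col 0 X + b *: col 1 X.
Proof. by apply/colP=> i; rewrite mulmx2E !mxE /=; ring. Qed.

Lemma stdcol_neq0 k : stdcol k != 0.
Proof.
case: k => [|[|k]]; rewrite /stdcol /= ?nth_nil; apply/eqP => /colP;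
  [move=> /(_ 0) | move=> /(_ 1) | move=> /(_ 0)];
  by rewrite !mxE /= => /eqP; rewrite oner_eq0.
Qed.

(** Three distinct points of the projective line form a frame: the columns [x0] and [x1] are
    rescaled by the coordinates of [x2], both nonzero. *)
Lemma frame_of_lines (x0 x1 x2 : 'cV[K]_2) :
    x0 != 0 -> x1 != 0 -> x2 != 0 -> (forall k, x0 <> k *: x1) ->
    (forall k, x2 <> k *: x0) -> (forall k, x2 <> k *: x1) ->
  exists2 X : 'M[K]_2, X \in unitmx &
    exists k0 k1, [/\ x0 = k0 *: (X *m stdcol 0), x1 = k1 *: (X *m stdcol 1)
                    & x2 = X *m stdcol 2].
Proof.
move=> x00 x10 x20 n01 n20 n21.
pose Y : 'M[K]_2 := row_mx x0 x1.
have Y0 : col 0 Y = x0.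
  by apply/colP=> i; rewrite mxE -(row_mxEl x0 x1 i 0); congr (Y i _);
    apply: val_inj.
have Y1 : col 1 Y = x1.
  by apply/colP=> i; rewrite mxE -(row_mxEr x0 x1 i 0); congr (Y i _);
    apply: val_inj.
have uY : Y \in unitmx.
  rewrite unitmxE unitfE -det_tr; apply/eqP => /eqP /det0P[v v0 /(congr1 trmx)].
  rewrite trmx_mul trmxK trmx0 [v^T]col2E mulmx_col2 Y0 Y1.
  set a := v^T 0 0; set b := v^T 1 0 => lin.
  have [a0|a0] := eqVneq a 0.
    move: lin; rewrite a0 scale0r add0r => /eqP;
      rewrite scaler_eq0 (negPf x10) orbF => /eqP b0.
    case/eqP: v0; apply: trmx_inj; rewrite trmx0 [v^T]col2E -/a -/b a0 b0.
    by apply/colP; apply: ord2P; rewrite !mxE.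
  apply: (n01 (- (b / a))); apply: (scalerI a0);
    rewrite scalerA mulrN mulrCA divff // mulr1.
  by apply/eqP; rewrite scaleNr -addr_eq0 lin.
pose w := invmx Y *m x2.
have x2E : x2 = w 0 0 *: x0 + w 1 0 *: x1
  by rewrite -Y0 -Y1 -mulmx_col2 -col2E mulKVmx.
have w0 : w 0 0 != 0.
  by apply/eqP => w0; apply: (n21 (w 1 0)); rewrite x2E w0 scale0r add0r.
have w1 : w 1 0 != 0.
  by apply/eqP => w1; apply: (n20 (w 0 0)); rewrite x2E w1 scale0r addr0.
pose D : 'M[K]_2 := diag_mx (w^T).
have uD : D \in unitmx.
  rewrite unitmxE det_diag unitfE; apply/prodf_neq0 => i _.
  by move: i; apply: ord2P; rewrite mxE.
have De a b : D *m col2 a b = col2 (w 0 0 * a) (w 1 0 * b).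
  by apply/colP; apply: ord2P; rewrite mul_diag_mx !mxE.
exists (Y *m D); first by rewrite unitmx_mul uY.
exists (w 0 0)^-1, (w 1 0)^-1;
  rewrite /stdcol /= -!mulmxA !De !mulr1 !mulr0 !mulmx_col2 Y0 Y1.
by split; rewrite ?scale0r ?addr0 ?add0r ?scalerA ?mulVf ?scale1r.
Qed.

(** If two of the vectors were parallel, three distinct [M i] would kill the same vector. *)
Lemma frame_of_kernels M N O (x0 x1 x2 : 'cV[K]_2) i0 j0 i1 j1 i2 j2 : trdecomp M N
  O ->
    x0 != 0 -> x1 != 0 -> x2 != 0 -> uniq [:: i0; j0; i1; j1; i2; j2] ->
    M i0 *m x0 = 0 -> M j0 *m x0 = 0 -> M i1 *m x1 = 0 -> M j1 *m x1 = 0 ->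
    M i2 *m x2 = 0 ->
  exists2 X : 'M[K]_2, X \in unitmx &
    exists k0 k1, [/\ x0 = k0 *: (X *m stdcol 0), x1 = k1 *: (X *m stdcol 1)
                    & x2 = X *m stdcol 2].
Proof.
move=> dec x00 x10 x20; rewrite /= !inE !negb_or -!andbA.
do 15![case/andP=> ?] => _ Mi0 Mj0 Mi1 Mj1 Mi2.
have par (x x' : 'cV[K]_2) i j k c : x != 0 -> x' != 0 -> M i *m x = 0 -> M j *m x'
  = 0 ->
    M k *m x' = 0 -> uniq [:: i; j; k] -> x <> c *: x'.
  move=> n n' Mi Mj Mk un xx'.
  have c0 : c != 0 by apply: contraNneq n => c0; rewrite xx' c0 scale0r.
  have Mi' : M i *m x' = 0.
    by apply: (scalerI c0); rewrite scaler0 scalemxAr -xx'.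
  by have := kill_col_uniq dec n' Mi' Mj Mk; rewrite un.
apply: frame_of_lines => // k.
- by apply: (par _ _ i0 i1 j1); rewrite //= !inE !negb_or; do !(apply/andP;
  split=> //).
- by apply: (par _ _ i2 i0 j0); rewrite //= !inE !negb_or; do !(apply/andP;
  split=> //); rewrite eq_sym.
- by apply: (par _ _ i2 i1 j1); rewrite //= !inE !negb_or; do !(apply/andP;
  split=> //); rewrite eq_sym.
Qed.

(** The Brent equations, read off on matrix units. *)
Lemma trdecomp_entries M N O (i j k l m n : 'I_2) : trdecomp M N O ->
  \sum_r M r j i * N r l k * O r n m = ((j == k) && (l == m) && (n == i))%:R.
Proof.
move=> dec; have tr_delta (A : 'M[K]_2) a b : \tr (A *m delta_mx a b) = A b a.
  rewrite -(@mul_delta_mx K 2 1 2 0) mulmxA mxtrace_mulC.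
  by rewrite -colE -rowE trace_mx11 !mxE.
have := dec (delta_mx i j) (delta_mx k l) (delta_mx m n).
under eq_bigr do rewrite !tr_delta.
move=> ->; rewrite tr_delta mul_delta_mx_cond mulmxnE mxE [m == l]eq_sym.
by case: (j == k); case: (l == m); case: (n == i); rewrite /= ?mulr0n ?mulr1n.
Qed.

Lemma big_ord7 (T : Type) (idx : T) (op : Monoid.com_law idx) (F : 'I_7 -> T)
    i1 i2 i3 i4 i5 i6 i7 : uniq [:: i1; i2; i3; i4; i5; i6; i7] ->
  \big[op/idx]_i F i =
  op (F i1) (op (F i2) (op (F i3) (op (F i4) (op (F i5) (op (F i6) (F i7)))))).
Proof.
move=> un; have pe : perm_eq (index_enum 'I_7) [:: i1; i2; i3; i4; i5; i6; i7].
  apply: uniq_perm => //; first exact: index_enum_uniq.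
  move=> i; rewrite mem_index_enum; apply/esym/negPn/negP => ni.
  have : uniq (i :: [:: i1; i2; i3; i4; i5; i6; i7]) by rewrite cons_uniq ni.
  by move/uniq_ord_size.
by rewrite (perm_big _ pe) /= !big_cons big_nil /= Monoid.mulm1.
Qed.

(** Rescaling leaves only the product [k * l * m] determined. It turns out to be the sign of the
    permutation [(a, b, c)]; its square is enough for squared norms. *)
Definition solved M N O X Y Z i a b c :=
  exists k l m, [/\ M i = k *: (X *m stdcol b *m (stdrow c *m invmx Y)),
    N i = l *: (Z *m stdcol c *m (stdrow a *m invmx X)),
    O i = m *: (Y *m stdcol a *m (stdrow b *m invmx Z)) & (k * l * m) ^+ 2 = 1].

Definition central M N O X Y Z i :=
  exists k l m, [/\ M i = k *: (X *m invmx Y), N i = l *: (Z *m invmx X),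
    O i = m *: (Y *m invmx Z) & (k * l * m) ^+ 2 = 1].

Lemma mulrow_stdcol_eq0 (y : 'rV[K]_2) k : (k < 3)%N -> y *m stdcol k = 0 ->
  exists c, y = c *: stdrow k.
Proof.
move=> k3 yk; have {yk} : (y *m stdcol k) 0 0 = 0 by rewrite yk mxE.
rewrite mulmx2E; case: k k3 => [|[|[|//]]] _; rewrite /stdcol /stdrow /= !mxE /=.
- rewrite mulr1 mulr0 addr0 => y0; exists (y 0 1).
  by apply/rowP; apply: ord2P; rewrite !mxE /= ?y0 ?mulr0 ?mulr1.
- rewrite mulr1 mulr0 add0r => y0; exists (y 0 0).
  by apply/rowP; apply: ord2P; rewrite !mxE /= ?y0 ?mulr0 ?mulr1.
rewrite !mulr1 => y0; exists (y 0 0).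
apply/rowP; apply: ord2P; rewrite !mxE /= ?mulr1 // mulrN1.
by apply/eqP; rewrite -addr_eq0 addrC y0.
Qed.

(** The first two eigenvectors make [A] diagonal, and their sum, the third, makes the two
    eigenvalues equal. *)
Lemma stdcol_eigen_scalar (A : 'M[K]_2) :
  (forall k, (k < 3)%N -> exists c, A *m stdcol k = c *: stdcol k) -> exists c,
    A = c%:M.
Proof.
move=> eig; have [a Aa] := eig 0%N isT; have [b Ab] := eig 1%N isT;
  have [c Ac] := eig 2%N isT.
have e0 i := congr1 (fun v : 'cV_2 => v i 0) Aa.
have e1 i := congr1 (fun v : 'cV_2 => v i 0) Ab.
have e2 i := congr1 (fun v : 'cV_2 => v i 0) Ac.
move: (e0 0) (e0 1) (e1 0) (e1 1) (e2 0) (e2 1).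
rewrite !mulmx2E /stdcol /= !mxE /= !(mulr0, mulr1, addr0, add0r) =>
  A00 A10 A01 A11 C0 C1.
exists c; apply: mx22P; rewrite !mxE /= ?mulr1n ?mulr0n ?A10 ?A01 //.
- by rewrite -C0 A01 addr0.
- by rewrite -C1 A10 add0r.
Qed.

Lemma triad_sandwich M N O X Y Z (a b c : seq 'I_7) e x z u kx kz ku t :
    X \in unitmx -> Y \in unitmx -> Z \in unitmx -> triad M N O a b c e x z u ->
    x = kx *: (X *m stdcol t) -> z = kz *: (Z *m stdcol t) ->
    u = ku *: (Y *m stdcol t) ->
  triad (fun i => invmx X *m M i *m Y) (fun i => invmx Z *m N i *m X)
        (fun i => invmx Y *m O i *m Z) a b c e (stdcol t) (stdcol t) (stdcol t).
Proof.
move=> uX uY uZ [[x0 z0 u0] Ta Tb Tc [[k1 e1] [k2 e2] [k3 e3]]] xE zE uE.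
have nz (y : 'cV[K]_2) k v : y != 0 -> y = k *: v -> k != 0.
  by move=> y0 yE; apply: contraNneq y0 => k0; rewrite yE k0 scale0r.
have kx0 := nz _ _ _ x0 xE; have kz0 := nz _ _ _ z0 zE; have ku0 := nz _ _ _ u0 uE.
have inv (W : 'M[K]_2) y k : k != 0 -> y = k *: (W *m stdcol t) ->
    W *m stdcol t = k^-1 *: y.
  by move=> k0 ->; rewrite scalerA mulVf // scale1r.
have xI := inv _ _ _ kx0 xE; have zI := inv _ _ _ kz0 zE;
  have uI := inv _ _ _ ku0 uE.
have back (W : 'M[K]_2) y k : W \in unitmx -> y = k *: (W *m stdcol t) ->
    invmx W *m y = k *: stdcol t.
  by move=> uW ->; rewrite -scalemxAr mulKmx.
have xB := back _ _ _ uX xE; have zB := back _ _ _ uZ zE;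
  have uB := back _ _ _ uY uE.
split; first by split; apply: stdcol_neq0.
- move=> i /Ta[Ni [y Oi]]; split.
    by rewrite -!mulmxA xI -!scalemxAr Ni mulmx0 scaler0.
  by exists (ku *: (y *m Z)); rewrite Oi !mulmxA uB -!scalemxAl -scalemxAr mulmxA.
- move=> i /Tb[Oi [y Mi]]; split.
    by rewrite -!mulmxA zI -!scalemxAr Oi mulmx0 scaler0.
  by exists (kx *: (y *m Y)); rewrite Mi !mulmxA xB -!scalemxAl -scalemxAr mulmxA.
- move=> i /Tc[Mi [y Ni]]; split.
    by rewrite -!mulmxA uI -!scalemxAr Mi mulmx0 scaler0.
  by exists (kz *: (y *m X)); rewrite Ni !mulmxA zB -!scalemxAl -scalemxAr mulmxA.
split.
- by exists (ku^-1 * k1 * kx);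
  rewrite -!mulmxA uI -!scalemxAr e1 -scalemxAr xB !scalerA.
- by exists (kx^-1 * k2 * kz);
  rewrite -!mulmxA xI -!scalemxAr e2 -scalemxAr zB !scalerA.
by exists (kz^-1 * k3 * ku);
  rewrite -!mulmxA zI -!scalemxAr e3 -scalemxAr uB !scalerA.
Qed.

Definition stdtriad M N O a b c e t :=
  triad M N O a b c e (stdcol t) (stdcol t) (stdcol t).

(** Between them, the three triads give each factor of product [i] both its image and its kernel,
    hence the factor up to a scalar. *)
Lemma stdtriad_factors M N O i a1 b1 c1 a2 b2 c2 a3 b3 c3 e a b c :
    stdtriad M N O a1 b1 c1 e a -> stdtriad M N O a2 b2 c2 e b ->
    stdtriad M N O a3 b3 c3 e c -> (a < 3)%N -> (b < 3)%N -> (c < 3)%N ->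
    i \in a1 -> i \in b2 -> i \in c3 ->
  exists k l m, [/\ M i = k *: (stdcol b *m stdrow c),
    N i = l *: (stdcol c *m stdrow a) & O i = m *: (stdcol a *m stdrow b)].
Proof.
move=> [_ Ta _ _ _] [_ _ Tb _ _] [_ _ _ Tc _] a3' b3' c3' /Ta[Na [yo Oa]] /Tb[Ob
  [ym Mb]] /Tc[Mc [yn Nc]].
have fact (W : 'M[K]_2) s t y : (t < 3)%N -> W = stdcol s *m y -> W *m stdcol t = 0
  ->
    exists k, W = k *: (stdcol s *m stdrow t).
  move=> t3 ->; rewrite -mulmxA => /(col_mul_eq0 (stdcol_neq0 s)).
  by move/(mulrow_stdcol_eq0 t3) => [k ->]; exists k; rewrite -scalemxAr.
have [k Mk] := fact _ _ _ _ c3' Mb Mc; have [l Nl] := fact _ _ _ _ a3' Nc Na.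
by have [m Om] := fact _ _ _ _ b3' Oa Ob; exists k, l, m.
Qed.

Lemma stdtriads_solve M N O i1 i2 i3 i4 i5 i6 i7 : trdecomp M N O ->
    uniq [:: i1; i2; i3; i4; i5; i6; i7] ->
    stdtriad M N O [:: i1; i2] [:: i3; i4] [:: i5; i6] i7 0 ->
    stdtriad M N O [:: i3; i5] [:: i1; i6] [:: i2; i4] i7 1 ->
    stdtriad M N O [:: i4; i6] [:: i2; i5] [:: i1; i3] i7 2 ->
  [/\ [/\ solved M N O 1%:M 1%:M 1%:M i1 0 1 2,
          solved M N O 1%:M 1%:M 1%:M i2 0 2 1 &
          solved M N O 1%:M 1%:M 1%:M i3 1 0 2],
      [/\ solved M N O 1%:M 1%:M 1%:M i4 2 0 1,
          solved M N O 1%:M 1%:M 1%:M i5 1 2 0 &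
          solved M N O 1%:M 1%:M 1%:M i6 2 1 0] &
      central M N O 1%:M 1%:M 1%:M i7].
Proof.
move=> dec un T0 T1 T2.
have [|||k1 [l1 [m1 [M1 N1 O1]]]] := stdtriad_factors (i :=
  i1) T0 T1 T2 isT isT isT; rewrite ?inE ?eqxx ?orbT //.
have [|||k2 [l2 [m2 [M2 N2 O2]]]] := stdtriad_factors (i :=
  i2) T0 T2 T1 isT isT isT; rewrite ?inE ?eqxx ?orbT //.
have [|||k3 [l3 [m3 [M3 N3 O3]]]] := stdtriad_factors (i :=
  i3) T1 T0 T2 isT isT isT; rewrite ?inE ?eqxx ?orbT //.
have [|||k4 [l4 [m4 [M4 N4 O4]]]] := stdtriad_factors (i :=
  i4) T2 T0 T1 isT isT isT; rewrite ?inE ?eqxx ?orbT //.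
have [|||k5 [l5 [m5 [M5 N5 O5]]]] := stdtriad_factors (i :=
  i5) T1 T2 T0 isT isT isT; rewrite ?inE ?eqxx ?orbT //.
have [|||k6 [l6 [m6 [M6 N6 O6]]]] := stdtriad_factors (i :=
  i6) T2 T1 T0 isT isT isT; rewrite ?inE ?eqxx ?orbT //.
have [_ _ _ _ [eM0 eN0 eO0]] := T0; have [_ _ _ _ [eM1 eN1 eO1]] := T1.
have [_ _ _ _ [eM2 eN2 eO2]] := T2.
have [k7 M7] : exists c, M i7 = c%:M.
  by apply: stdcol_eigen_scalar => -[|[|[|//]]].
have [l7 N7] : exists c, N i7 = c%:M.
  by apply: stdcol_eigen_scalar => -[|[|[|//]]].
have [m7 O7] : exists c, O i7 = c%:M.
  by apply: stdcol_eigen_scalar => -[|[|[|//]]].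
have colrow (x : 'cV[K]_2) (y : 'rV[K]_2) i j : (x *m y) i j = x i 0 * y 0 j.
  by rewrite mxE big_ord1.
have entE := (M1, M2, M3, M4, M5, M6, M7, N1, N2, N3, N4, N5, N6, N7, O1, O2, O3,
  O4, O5, O6, O7).
(* Each of the seven equations below uses a choice of entries at which all products but one
   vanish. *)
have s1 : k1 * l1 * m1 = 1.
  have := trdecomp_entries 0 1 1 0 0 0 dec; rewrite (big_ord7 _ _ un) !entE.
  by rewrite /stdcol /stdrow /= !(mxE, colrow) /= => e; apply: etrans e; ring.
have s2 : - (k2 * l2 * m2) = 1.
  have := trdecomp_entries 0 1 1 1 1 0 dec; rewrite (big_ord7 _ _ un) !entE.
  by rewrite /stdcol /stdrow /= !(mxE, colrow) /= => e; apply: etrans e; ring.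
have s3 : - (k3 * l3 * m3) = 1.
  have := trdecomp_entries 1 0 0 1 1 1 dec; rewrite (big_ord7 _ _ un) !entE.
  by rewrite /stdcol /stdrow /= !(mxE, colrow) /= => e; apply: etrans e; ring.
have s4 : k4 * l4 * m4 = 1.
  have := trdecomp_entries 0 0 0 1 1 0 dec; rewrite (big_ord7 _ _ un) !entE.
  by rewrite /stdcol /stdrow /= !(mxE, colrow) /= => e; apply: etrans e; ring.
have s5 : k5 * l5 * m5 = 1.
  have := trdecomp_entries 1 0 0 0 0 1 dec; rewrite (big_ord7 _ _ un) !entE.
  by rewrite /stdcol /stdrow /= !(mxE, colrow) /= => e; apply: etrans e; ring.
have s6 : - (k6 * l6 * m6) = 1.
  have := trdecomp_entries 1 1 1 0 0 1 dec; rewrite (big_ord7 _ _ un) !entE.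
  by rewrite /stdcol /stdrow /= !(mxE, colrow) /= => e; apply: etrans e; ring.
have s7 : k7 * l7 * m7 = 1.
  have := trdecomp_entries 0 0 0 0 0 0 dec; rewrite (big_ord7 _ _ un) !entE.
  by rewrite /stdcol /stdrow /= !(mxE, colrow) /= => e; apply: etrans e; ring.
have sqr1 a : a = 1 \/ - a = 1 -> a ^+ 2 = 1 :> K.
  by case=> [-> | a1]; [rewrite expr1n | rewrite -sqrrN a1 expr1n].
split; [split | split | ].
- by exists k1, l1, m1; rewrite invmx1 !mul1mx !mulmx1; split=> //; apply: sqr1;
  auto.
- by exists k2, l2, m2; rewrite invmx1 !mul1mx !mulmx1; split=> //; apply: sqr1;
  auto.
- by exists k3, l3, m3; rewrite invmx1 !mul1mx !mulmx1; split=> //; apply: sqr1;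
  auto.
- by exists k4, l4, m4; rewrite invmx1 !mul1mx !mulmx1; split=> //; apply: sqr1;
  auto.
- by exists k5, l5, m5; rewrite invmx1 !mul1mx !mulmx1; split=> //; apply: sqr1;
  auto.
- by exists k6, l6, m6; rewrite invmx1 !mul1mx !mulmx1; split=> //; apply: sqr1;
  auto.
exists k7, l7, m7; rewrite invmx1 !mulmx1 !scalemx1; split=> //; apply: sqr1; auto.
Qed.

Lemma solved_sandwich M N O X Y Z i a b c :
    X \in unitmx -> Y \in unitmx -> Z \in unitmx ->
    solved (fun i => invmx X *m M i *m Y) (fun i => invmx Z *m N i *m X)
      (fun i => invmx Y *m O i *m Z) 1%:M 1%:M 1%:M i a b c ->
  solved M N O X Y Z i a b c.
Proof.
move=> uX uY uZ [k [l [m []]]]; rewrite invmx1 !mul1mx !mulmx1 => Mi Ni Oi klm.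
have back (U V W D : 'M[K]_2) k' x y : U \in unitmx -> V \in unitmx ->
    invmx U *m W *m V = k' *: (stdcol x *m stdrow y) ->
    W = k' *: (U *m stdcol x *m (stdrow y *m invmx V)).
  move=> uU uV /(congr1 (fun P => U *m P *m invmx V)).
  by rewrite -!mulmxA mulmxV // mulmx1 mulKVmx // => ->;
    rewrite -!scalemxAl -scalemxAr !mulmxA.
by exists k, l, m; split=> //; apply: back.
Qed.

Lemma central_sandwich M N O X Y Z i :
    X \in unitmx -> Y \in unitmx -> Z \in unitmx ->
    central (fun i => invmx X *m M i *m Y) (fun i => invmx Z *m N i *m X)
      (fun i => invmx Y *m O i *m Z) 1%:M 1%:M 1%:M i ->
  central M N O X Y Z i.
Proof.
move=> uX uY uZ [k [l [m []]]]; rewrite invmx1 !mulmx1 => Mi Ni Oi klm.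
have back (U V W : 'M[K]_2) k' : U \in unitmx -> V \in unitmx ->
    invmx U *m W *m V = k' *: 1%:M -> W = k' *: (U *m invmx V).
  move=> uU uV /(congr1 (fun P => U *m P *m invmx V)).
  by rewrite -!mulmxA mulmxV // mulmx1 mulKVmx // => ->;
    rewrite -!scalemxAl -scalemxAr mul1mx.
by exists k, l, m; split=> //; apply: back.
Qed.

Lemma normal_form M N O i1 i2 : trdecomp M N O -> linked M i1 i2 ->
  exists i3 i4 i5 i6 i7 X Y Z,
  [/\ uniq [:: i1; i2; i3; i4; i5; i6; i7],
      [/\ X \in unitmx, Y \in unitmx & Z \in unitmx],
      [/\ solved M N O X Y Z i1 0 1 2, solved M N O X Y Z i2 0 2 1 &
          solved M N O X Y Z i3 1 0 2],
      [/\ solved M N O X Y Z i4 2 0 1, solved M N O X Y Z i5 1 2 0 &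
          solved M N O X Y Z i6 2 1 0] &
      central M N O X Y Z i7].
Proof.
move=> dec M12.
have [i3 [i4 [i5 [i6 [i7 [un [x0 [z0 [u0 T0]]] [x1 [z1 [u1 T1]]] [x2 [z2 [u2
  T2]]]]]]]]] :=
  hexagon dec M12.
have dec1 := trdecomp_rot dec; have dec2 := trdecomp_rot dec1.
have [[x00 z00 u00] A0 B0 C0 _] := T0; have [[x10 z10 u10] A1 B1 C1 _] := T1.
have [[x20 z20 u20] A2 B2 C2 _] := T2.
have un6 s : perm_eq s [:: i1; i2; i3; i4; i5; i6] -> uniq s.
  move/perm_uniq->; move: un.
  by rewrite -[X in uniq X]/([:: i1; i2; i3; i4; i5;
    i6] ++ [:: i7]) cat_uniq => /and3P[].
have kill (F : 'I_7 -> 'M[K]_2) (G : 'I_7 -> Prop) i j x :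
    (forall k, k \in [:: i; j] -> F k *m x = 0 /\ G k) ->
    F i *m x = 0 :> 'cV_2 /\ F j *m x = 0 :> 'cV_2.
  by move=> Fs; split; [case: (Fs i) | case: (Fs j)]; rewrite // !inE eqxx ?orbT.
(* The [x] vectors are killed by the [N] of the first lists, the [z] by the [O] of the second, the
   [u] by the [M] of the third; they provide the frames [X], [Z] and [Y]. *)
have [|X uX [a0 [a1 [xE0 xE1 xE2]]]] :=
  @frame_of_kernels _ _ _ x0 x1 x2 i1 i2 i3 i5 i4 i6
  dec1 x00 x10 x20 _ (kill _ _ _ _ _ A0).1 (kill _ _ _ _ _ A0).2
  (kill _ _ _ _ _ A1).1 (kill _ _ _ _ _ A1).2 (kill _ _ _ _ _ A2).1.
  by apply: un6; apply/seq.permP => P /=; ring.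
have [|Z uZ [b0 [b1 [zE0 zE1 zE2]]]] :=
  @frame_of_kernels _ _ _ z0 z1 z2 i3 i4 i1 i6 i2 i5
  dec2 z00 z10 z20 _ (kill _ _ _ _ _ B0).1 (kill _ _ _ _ _ B0).2
  (kill _ _ _ _ _ B1).1 (kill _ _ _ _ _ B1).2 (kill _ _ _ _ _ B2).1.
  by apply: un6; apply/seq.permP => P /=; ring.
have [|Y uY [c0 [c1 [uE0 uE1 uE2]]]] :=
  @frame_of_kernels _ _ _ u0 u1 u2 i5 i6 i2 i4 i1 i3
  dec u00 u10 u20 _ (kill _ _ _ _ _ C0).1 (kill _ _ _ _ _ C0).2
  (kill _ _ _ _ _ C1).1 (kill _ _ _ _ _ C1).2 (kill _ _ _ _ _ C2).1.
  by apply: un6; apply/seq.permP => P /=; ring.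
have S0 := triad_sandwich uX uY uZ T0 xE0 zE0 uE0.
have S1 := triad_sandwich uX uY uZ T1 xE1 zE1 uE1.
have one (x : 'cV[K]_2) : x = 1 *: x by rewrite scale1r.
have S2 := triad_sandwich uX uY uZ T2 (etrans xE2 (one _)) (etrans zE2 (one _))
  (etrans uE2 (one _)).
have [[r1 r2 r3] [r4 r5 r6] r7] :=
  stdtriads_solve (trdecomp_sandwich uX uY uZ dec) un S0 S1 S2.
exists i3, i4, i5, i6, i7, X, Y, Z; split=> //; last exact: central_sandwich r7.
  by split; apply: solved_sandwich.
by split; apply: solved_sandwich.
Qed.

End NormalForm.

(** * Norms *)

Section Norms.
Variable R : realFieldType.

Definition frob2 m n (A : 'M[R]_(m, n)) := \sum_i \sum_j A i j ^+ 2.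

Lemma frob2_ge0 m n (A : 'M[R]_(m, n)) : 0 <= frob2 A.
Proof. by apply: sumr_ge0 => i _; apply: sumr_ge0 => j _; apply: sqr_ge0. Qed.

Lemma frob2Z m n k (A : 'M[R]_(m, n)) : frob2 (k *: A) = k ^+ 2 * frob2 A.
Proof.
rewrite /frob2 mulr_sumr; apply: eq_bigr => i _; rewrite mulr_sumr.
by apply: eq_bigr => j _; rewrite mxE exprMn.
Qed.

Lemma frob2_dyad m n (x : 'cV[R]_m) (y : 'rV[R]_n) : frob2 (x *m y) = frob2 x *
  frob2 y.
Proof.
rewrite /frob2 big_ord1 mulr_suml; apply: eq_bigr => i _.
rewrite big_ord1 mulr_sumr; apply: eq_bigr => j _.
by rewrite mxE big_ord1 exprMn.
Qed.

Lemma frob2_col2 (x : 'cV[R]_2) : frob2 x = x 0 0 ^+ 2 + x 1 0 ^+ 2.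
Proof. by rewrite /frob2 big_ord2 !big_ord1. Qed.

Lemma frob2_row2 (x : 'rV[R]_2) : frob2 x = x 0 0 ^+ 2 + x 0 1 ^+ 2.
Proof. by rewrite /frob2 big_ord1 big_ord2. Qed.

(** Schur's inequality of degree 3, rearranged. *)
Lemma schur3 (a b c : R) : 0 <= a -> 0 <= b -> 0 <= c ->
  (a + b + c) * (2 * (a * b + b * c + c * a) - (a ^+ 2 + b ^+ 2 + c ^+ 2)) <= 9 *
    (a * b * c).
Proof.
have ordered (x y z : R) : 0 <= z -> z <= y -> y <= x ->
  (x + y + z) * (2 * (x * y + y * z + z * x) - (x ^+ 2 + y ^+ 2 + z ^+ 2)) <= 9 *
    (x * y * z).
  move=> z0 zy yx; rewrite -subr_ge0.
  have -> : 9 * (x * y * z) -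
      (x + y + z) * (2 * (x * y + y * z + z * x) - (x ^+ 2 + y ^+ 2 + z ^+ 2)) =
    (x - y) ^+ 2 * (x + y - z) + z * ((x - z) * (y - z)) by ring.
  by rewrite addr_ge0 ?mulr_ge0 ?sqr_ge0 ?subr_ge0 //; lra.
move=> a0 b0 c0.
have [ab|/ltW ab] := leP a b; have [bc|/ltW bc] := leP b c;
  have [ac|/ltW ac] := leP a c.
- by have := ordered c b a a0 ab bc; lra.
- by have := ordered c b a a0 ab bc; lra.
- by have := ordered b c a a0 ac bc; lra.
- by have := ordered b a c c0 ac ab; lra.
- by have := ordered c a b b0 ab ac; lra.
- by have := ordered a c b b0 bc ac; lra.
- by have := ordered a b c c0 bc ab; lra.
- by have := ordered a b c c0 bc ab; lra.
Qed.

(* With a, b, c the squared sides of a triangle, Q is 16 times its squared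
   area: among the triangles of given area the equilateral one minimises the
   product of the sides. *)
Lemma triangle_sides_area (a b c : R) : 0 <= a -> 0 <= b -> 0 <= c ->
  let Q := 2 * (a * b + b * c + c * a) - (a ^+ 2 + b ^+ 2 + c ^+ 2) in
  0 <= Q -> Q ^+ 3 <= 27 * (a * b * c) ^+ 2.
Proof.
move=> a0 b0 c0 Q Q0; have := schur3 a0 b0 c0; rewrite -/Q;
  set s := a + b + c => sQ.
have s0 : 0 <= s by rewrite !addr_ge0.
have Qs : 3 * Q <= s ^+ 2.
  have := sqr_ge0 (a - b); have := sqr_ge0 (b - c); have := sqr_ge0 (c - a).
  by rewrite /Q /s; lra.
have sQ2 : s ^+ 2 * Q ^+ 2 <= 81 * (a * b * c) ^+ 2.
  have -> : 81 * (a * b * c) ^+ 2 = (9 * (a * b * c)) ^+ 2 by ring.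
  by rewrite -exprMn ler_pXn2r // nnegrE ?mulr_ge0.
have : 3 * Q * Q ^+ 2 <= s ^+ 2 * Q ^+ 2 by rewrite ler_wpM2r ?sqr_ge0.
lra.
Qed.

(** The three images are the sides of a triangle of area |\det W| / 2, for which the quantity Q of
    [triangle_sides_area] is 4 * \det W ^+ 2. *)
Lemma prod_col_norms (W : 'M[R]_2) :
  64 * \det W ^+ 6 <= 27 * (frob2 (W *m stdcol R 0) * frob2 (W *m stdcol R 1) *
    frob2 (W *m stdcol R 2)) ^+ 2.
Proof.
have := triangle_sides_area (frob2_ge0 (W *m stdcol R 0)) (frob2_ge0 (W *m stdcol R
  1))
  (frob2_ge0 (W *m stdcol R 2)).
rewrite !frob2_col2 !mulmx2E !mxE /= det_mx22 => T.
apply: le_trans (T _); first by rewrite le_eqVlt; apply/orP; left; apply/eqP; ring.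
set p := W 0 0; set q := W 0 1; set r := W 1 0; set s := W 1 1.
by have := sqr_ge0 (p * s - q * r); lra.
Qed.

Lemma prod_row_norms (W : 'M[R]_2) :
  64 * \det W ^+ 6 <= 27 * (frob2 (stdrow R 0 *m W) * frob2 (stdrow R 1 *m W) *
    frob2 (stdrow R 2 *m W)) ^+ 2.
Proof.
have := triangle_sides_area (frob2_ge0 (stdrow R 0 *m W)) (frob2_ge0 (stdrow R 1 *m
  W))
  (frob2_ge0 (stdrow R 2 *m W)).
rewrite !frob2_row2 !mulmx2E !mxE /= det_mx22 => T.
apply: le_trans (T _); first by rewrite le_eqVlt; apply/orP; left; apply/eqP; ring.
set p := W 0 0; set q := W 0 1; set r := W 1 0; set s := W 1 1.
by have := sqr_ge0 (p * s - q * r); lra.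
Qed.

Lemma frob2_det (W : 'M[R]_2) : 4 * \det W ^+ 2 <= frob2 W ^+ 2.
Proof.
rewrite /frob2 !big_ord2 det_mx22 -subr_ge0.
set p := W 0 0; set q := W 0 1; set r := W 1 0; set s := W 1 1.
(* The factors are [frob2 W] minus and plus twice the determinant. *)
have -> : (p ^+ 2 + q ^+ 2 + (r ^+ 2 + s ^+ 2)) ^+ 2 - 4 * (p * s - q * r) ^+ 2 =
  ((p - s) ^+ 2 + (q + r) ^+ 2) * ((p + s) ^+ 2 + (q - r) ^+ 2) by ring.
by rewrite mulr_ge0 ?addr_ge0 ?sqr_ge0.
Qed.

End Norms.

(** * Lower bound for the product of the squared norms *)

Section ProductBound.
Variable R : realFieldType.
Implicit Types M N O : 'I_7 -> 'M[R]_2.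

Let cn (X : 'M[R]_2) k := frob2 (X *m stdcol R k).
Let rn (X : 'M[R]_2) k := frob2 (stdrow R k *m invmx X).

Lemma solved_norms M N O X Y Z i a b c : solved M N O X Y Z i a b c ->
  frob2 (M i) * frob2 (N i) * frob2 (O i) =
  cn X b * rn Y c * (cn Z c * rn X a) * (cn Y a * rn Z b).
Proof.
case=> k [l [m [-> -> -> klm]]];
  rewrite !frob2Z !frob2_dyad -/(cn X b) -/(cn Z c) -/(cn Y a).
rewrite -/(rn X a) -/(rn Y c) -/(rn Z b) -[RHS]mul1r -klm; ring.
Qed.

Lemma ler_pM3 (a b c a' b' c' : R) : 0 <= a -> 0 <= b -> 0 <= c ->
  a <= a' -> b <= b' -> c <= c' -> a * b * c <= a' * b' * c'.
Proof. by move=> a0 b0 c0 aa' bb' cc'; rewrite ler_pM ?mulr_ge0 // ler_pM. Qed.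

(** The determinants of X Y^-1, Z X^-1 and Y Z^-1 multiply to 1, so [frob2_det] leaves 2 * 2 * 2;
    the comparison is made between squares. *)
Lemma central_norms M N O X Y Z i : X \in unitmx -> Y \in unitmx -> Z \in unitmx ->
  central M N O X Y Z i -> 8 <= frob2 (M i) * frob2 (N i) * frob2 (O i).
Proof.
move=> uX uY uZ [k [l [m [-> -> -> klm]]]]; rewrite !frob2Z.
set f := frob2 (X *m _); set g := frob2 (Z *m _); set h := frob2 (Y *m _).
have -> : k ^+ 2 * f * (l ^+ 2 * g) * (m ^+ 2 * h) = f * g * h.
  by rewrite -[RHS]mul1r -klm; ring.
have pos : 0 <= f * g * h by rewrite !mulr_ge0 ?frob2_ge0.
rewrite -(@ler_pXn2r _ 2) ?nnegrE ?ler0n //.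
have nz (W : 'M[R]_2) : W \in unitmx -> \det W != 0 by rewrite unitmxE unitfE.
have -> : 8 ^+ 2 = (4 * \det (X *m invmx Y) ^+ 2) * (4 * \det (Z *m invmx X) ^+ 2) *
    (4 * \det (Y *m invmx Z) ^+ 2) :> R.
  by rewrite !det_mulmx !det_inv; field; rewrite !nz.
have pos4 (W : 'M[R]_2) : 0 <= 4 * \det W ^+ 2 by rewrite mulr_ge0 ?ler0n ?sqr_ge0.
by rewrite !exprMn; apply: ler_pM3; rewrite ?pos4 ?frob2_det.
Qed.

Lemma frame_norms X : X \in unitmx ->
  64 ^+ 2 <= 27 ^+ 2 * (cn X 0 * cn X 1 * cn X 2 * (rn X 0 * rn X 1 * rn X 2)) ^+ 2.
Proof.
rewrite unitmxE unitfE => d0; have c := prod_col_norms X;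
  have r := prod_row_norms (invmx X).
rewrite det_inv in r.
have -> : 64 ^+ 2 = (64 * \det X ^+ 6) * (64 * (\det X)^-1 ^+ 6) :> R by field.
have -> : 27 ^+ 2 * (cn X 0 * cn X 1 * cn X 2 * (rn X 0 * rn X 1 * rn X 2)) ^+ 2 =
  27 * (cn X 0 * cn X 1 * cn X 2) ^+ 2 * (27 * (rn X 0 * rn X 1 * rn X 2) ^+ 2)
    by ring.
by apply: ler_pM => //; rewrite mulr_ge0 // -[6%N]/(2 * 3)%N exprM exprn_ge0 //
  sqr_ge0.
Qed.

Lemma linked_prod_norms M N O i j : trdecomp M N O -> linked M i j ->
  2 ^+ 39 <= 3 ^+ 18 * \prod_i (frob2 (M i) * frob2 (N i) * frob2 (O i)).
Proof.
move=> dec /(normal_form dec)[i3 [i4 [i5 [i6 [i7 [X [Y [Z [un [uX uY uZ]]]]]]]]]].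
move=> [s1 s2 s3] [s4 s5 s6] s7; rewrite (big_ord7 _ _ un) /=.
rewrite (solved_norms s1) (solved_norms s2) (solved_norms s3).
rewrite (solved_norms s4) (solved_norms s5) (solved_norms s6).
have := central_norms uX uY uZ s7; set g := _ * frob2 (O i7) => g8.
(* Over the six permutations each index occurs twice in each position, whence the square. *)
pose q W := (cn W 0 * cn W 1 * cn W 2 * (rn W 0 * rn W 1 * rn W 2)) ^+ 2.
have := frame_norms uX; have := frame_norms uY; have := frame_norms uZ.
rewrite -/(q X) -/(q Y) -/(q Z) => zb yb xb.
rewrite [leRHS](_ : _ = 27 ^+ 2 * q X * (27 ^+ 2 * q Y) * (27 ^+ 2 * q Z) * g);
  last first.
  by rewrite /q; ring.
rewrite [leLHS](_ : _ = 64 ^+ 2 * 64 ^+ 2 * 64 ^+ 2 * 8); last by ring.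
have pos64 : 0 <= 64 ^+ 2 :> R by rewrite exprn_ge0 ?ler0n.
by apply: ler_pM; rewrite ?ler_pM3 ?mulr_ge0 ?ler0n.
Qed.

(** Rotating the decomposition does not change the products of norms, so a word for [M] or for [N]
    yields the bound. If the bound failed there would be neither, against [not_all_large]. *)
Lemma prod_norms M N O : trdecomp M N O ->
  2 ^+ 39 <= 3 ^+ 18 * \prod_i (frob2 (M i) * frob2 (N i) * frob2 (O i)).
Proof.
move=> dec; have [//|small] := boolP (_ <= _).
have large M' N' O' : trdecomp M' N' O' ->
    (forall i, frob2 (M' i) * frob2 (N' i) * frob2 (O' i) =
               frob2 (M i) * frob2 (N i) * frob2 (O i)) ->
    forall A, A != 0 -> (3 < #|supp M' A|)%N.
  move=> dec' norms A A0; rewrite ltnNge; apply: contra small => le3.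
  have [u [p [i [j [_ w]]]]] := word_of_small_supp dec' A0 le3.
  have := linked_prod_norms dec' (ex_intro _ u (ex_intro _ p w)).
  by under eq_bigr do rewrite norms.
case: (not_all_large dec); first exact: large dec _.
by apply: large (trdecomp_rot dec) _ => i; ring.
Qed.

End ProductBound.

(** * From matrix representations to the growth factor *)

Section Growth.
Variable K : realType.

Lemma sum_mxvec m n (A B : 'M[K]_(m, n)) :
  \sum_k mxvec A 0 k * mxvec B 0 k = \sum_i \sum_j A i j * B i j.
Proof.
rewrite pair_bigA /=.
rewrite (reindex _ (curry_mxvec_bij m n)) /=.
by apply: eq_bigr => -[i j] _ /=; rewrite !mxvecE.
Qed.

Lemma dot_mxtrace (A B : 'M[K]_2) : dot (mxvec A) (mxvec B) = \tr (A^T *m B).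
Proof.
rewrite /dot (sum_mxvec A B) exchange_big /=; apply: eq_bigr => j _.
by rewrite mxE; apply: eq_bigr => i _; rewrite mxE.
Qed.

Lemma norm2_vec_mx (v : 'rV[K]_(2 * 2)) : norm2 v = Num.sqrt (frob2 (vec_mx v)).
Proof.
rewrite /norm2 /frob2; congr Num.sqrt.
transitivity (\sum_k mxvec (vec_mx v) 0 k * mxvec (vec_mx v) 0 k).
  by apply: eq_bigr => k _; rewrite vec_mxK expr2.
by rewrite sum_mxvec; apply: eq_bigr => i _; apply: eq_bigr => j _; rewrite expr2.
Qed.

Lemma frob2_tr m n (A : 'M[K]_(m, n)) : frob2 A^T = frob2 A.
Proof.
rewrite /frob2 exchange_big /=; apply: eq_bigr => i _; apply: eq_bigr => j _.
by rewrite mxE.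
Qed.

Definition unvec (v : 'rV[K]_4) : 'M[K]_2 := @vec_mx K 2 2 v.

(** As [dot] is the form tr(A^T B), the factors from [L] and [R] are transposed. The one from [P] is
    not, because \tr (A *m B *m C) pairs the product [A *m B] with [C^T]. Permuting by [sigma^-1]
    restores the row-major order of the entries. *)
Lemma HM_trdecomp sigma (L R P : 'M[K]_(7, 4)) : is_HM sigma L R P ->
  trdecomp (fun i => (unvec (row i L))^T) (fun i => (unvec (row i R))^T)
           (fun i => unvec (row i (col_perm sigma^-1 P))).
Proof.
move=> HM A B C.
have dotE (v : 'rV[K]_4) D : \tr ((unvec v)^T *m D) = dot v (vec D).
  by rewrite -dot_mxtrace /unvec vec_mxK.
have dotE' (v : 'rV[K]_4) D : \tr (unvec v *m D) = dot v (vec D^T).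
  by rewrite -[unvec v]trmxK -[D in LHS]trmxK -trmx_mul mxtrace_tr mxtrace_mulC
    dotE.
have -> : \tr (A *m B *m C) = dot (vec (A *m B)) (vec C^T).
  by rewrite -dotE' /unvec mxvecK.
rewrite /dot (reindex_inj (@perm_inj _ sigma)) /=.
under [RHS]eq_bigr do rewrite -HM mulr_suml.
rewrite exchange_big /=; apply: eq_bigr => i _.
rewrite !dotE dotE' {3}/dot mulr_sumr (reindex_inj (@perm_inj _ sigma)) /=.
by apply: eq_bigr => j _; rewrite !mxE permK mulrA.
Qed.

Lemma norm2_col_perm sigma (P : 'M[K]_(7, 4)) i :
  norm2 (row i (col_perm sigma P)) = norm2 (row i P).
Proof.
rewrite /norm2 [in RHS](reindex_inj (@perm_inj _ sigma)) /=; congr Num.sqrt.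
by apply: eq_bigr => j _; rewrite !mxE.
Qed.

(** The exponent 14 is 7 from the mean of seven terms, doubled because the product bound concerns
    squared norms. *)
Lemma gamma21_bound sigma (L R P : 'M[K]_(7, 4)) : is_HM sigma L R P ->
  0 <= gamma21 L R P /\ 7 ^+ 14 * 2 ^+ 39 <= 3 ^+ 18 * gamma21 L R P ^+ 14.
Proof.
move=> HM; have bound := prod_norms (HM_trdecomp HM).
have n0 n (v : 'rV[K]_n) : 0 <= norm2 v by apply: sqrtr_ge0.
pose E i := norm2 (row i L) * norm2 (row i R) * norm2 (row i P).
have E0 i : 0 <= E i by rewrite !mulr_ge0.
have g0 : 0 <= gamma21 L R P by apply: sumr_ge0 => i _; apply: E0.
split=> //.
have agm : \prod_i E i <= ((\sum_i E i) / 7) ^+ 7.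
  have [+ _] := @leif_AGM K 'I_7 predT E (fun i _ => E0 i).
  by rewrite cardT size_enum_ord.
have prodE : \prod_i (frob2 (unvec (row i L))^T * frob2 (unvec (row i R))^T *
    frob2 (unvec (row i (col_perm sigma^-1 P)))) = (\prod_i E i) ^+ 2.
  rewrite -prodrXl; apply: eq_bigr => i _.
  rewrite /E -(norm2_col_perm sigma^-1 P) !norm2_vec_mx !exprMn !sqr_sqrtr
    ?frob2_ge0 //.
  by rewrite !frob2_tr.
rewrite prodE in bound.
have agm2 : 7 ^+ 14 * (\prod_i E i) ^+ 2 <= gamma21 L R P ^+ 14.
  have -> : 7 ^+ 14 * (\prod_i E i) ^+ 2 = (7 ^+ 7 * \prod_i E i) ^+ 2 by ring.
  rewrite -[14%N]/(7 * 2)%N exprM ler_pXn2r ?nnegrE ?exprn_ge0 ?mulr_ge0 ?exprn_ge0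
    ?prodr_ge0 //.
  have -> : gamma21 L R P ^+ 7 = 7 ^+ 7 * ((\sum_i E i) / 7) ^+ 7.
    by rewrite -exprMn [7 * _]mulrC divfK ?pnatr_eq0.
  by rewrite ler_pM2l ?exprn_gt0.
have := ler_wpM2l (exprn_ge0 18 (ler0n K 3)) agm2; apply: le_trans.
by rewrite [leRHS]mulrCA ler_pM2l ?exprn_gt0.
Qed.

End Growth.

Lemma powR_ratio_expn (K : realType) (a : K) (m n : nat) :
  0 <= a -> (0 < n)%N -> (a `^ (m%:R / n%:R)) ^+ n = a ^+ m.
Proof.
move=> a0 n0; rewrite -powR_mulrn ?powR_ge0 // -powRrM divfK ?pnatr_eq0 -?lt0n //.
by rewrite powR_mulrn.
Qed.

(* The leftmost term is the decimal 11.7554696, split up because ring literals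
   denote unary naturals. *)
Theorem corollary20 (K : realType) (sigma : {perm 'I_4})
    (L R P : 'M[K]_(7, 4)) (hHM : is_HM sigma L R P) :
  11 + 755 / 10 ^+ 3 + 469 / 10 ^+ 6 + 6 / 10 ^+ 7
    < 28 / 9 * (2 : K) `^ (11 / 14) * (3 : K) `^ (5 / 7) <= gamma21 L R P.
Proof.
have [g0 bound] := gamma21_bound hHM.
set t := 28 / 9 * _ * _.
have t0 : 0 <= t by rewrite !mulr_ge0 ?powR_ge0 ?invr_ge0 ?ler0n.
(* The 14th power clears the denominators 14 and 7 of the exponents, so that both comparisons
   involve only rational constants; its value is 7^14 * 2^39 / 3^18. *)
have t14 : t ^+ 14 = (28 / 9) ^+ 14 * 2 ^+ 11 * 3 ^+ 10.
  have p2 : ((2 : K) `^ (11 / 14)) ^+ 14 = 2 ^+ 11 by apply: (powR_ratio_expn 11).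
  have p3 : ((3 : K) `^ (5 / 7)) ^+ 14 = 3 ^+ 10.
    rewrite -[14%N]/(7 * 2)%N exprM (_ : _ ^+ 7 = 3 ^+ 5) -?exprM //.
    exact: (powR_ratio_expn 5).
  by rewrite /t 2!exprMn p2 p3.
apply/andP; split.
  rewrite -(@ltr_pXn2r _ 14) ?nnegrE //; last by lra.
  by rewrite t14; lra.
rewrite -(@ler_pXn2r _ 14) ?nnegrE // t14 -(@ler_pM2l _ (3 ^+ 18)) ?exprn_gt0 //.
apply: le_trans bound; rewrite le_eqVlt; apply/orP; left.
by apply/eqP; field.
Qed.
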